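(* Let $\Bbbk$ be an algebraically closed field of characteristic zero and let $H$ be a finite-dimensional cosemisimple Hopf algebra over $\Bbbk$. Then every right coideal subalgebra of $H$ is of the form $H_\lambda$ for some partial action $\lambda:H\to\Bbbk$, and $\lambda\mapsto H_\lambda$ is a one-to-one correspondence between partial actions of $H$ on $\Bbbk$ and right coideal subalgebras of $H$.
   Context: A partial action of $H$ on $\Bbbk$ is a linear map $\lambda:H\to\Bbbk$ with $\lambda(1_H)=1$ and $\lambda(h)\lambda(k)=\lambda(h_1)\lambda(h_2k)$ for all $h,k\in H$ (Sweedler notation). For such $\lambda$, $H_\lambda:=\{\lambda(h_1)h_2\mid h\in H\}\subseteq H$ (identified with the partial smash product $\underline{\Bbbk\#H}$). A right coideal subalgebra of $H$ is a unital subalgebra $B$ with $\Delta(B)\subseteq B\otimes H$; each $H_\lambda$ is one. *)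

(* Defs.v *)
From HB Require Import structures.
From mathcomp Require Import all_boot all_algebra all_field.

Set Implicit Arguments.
Unset Strict Implicit.
Unset Printing Implicit Defensive.

Import GRing.Theory.
Local Open Scope ring_scope.

(* V (x) W for finite-dimensional V and W, modelled by coordinate matrices    *)
(* with respect to the bases vbasis {:V} and vbasis {:W}. The pure tensors    *)
(* tens v w are the rank one matrices, and tlift f is the linear map induced  *)
(* by f : V -> W -> U; it is meaningful for bilinear f only, in which case it *)
(* satisfies the universal property tlift_tens.                               *)
Definition tensor (K : fieldType) (V W : vectType K) : Type :=
  'M[K]_(\dim {:V}, \dim {:W}).

HB.instance Definition _ (K : fieldType) (V W : vectType K) :=
  Vector.on (tensor V W).

Section Tensor.

Variables (K : fieldType) (V W : vectType K).

Definition tens (v : V) (w : W) : tensor V W :=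
  \matrix_(i, j) (coord (vbasis {:V}) i v * coord (vbasis {:W}) j w).

Definition tlift (U : lmodType K) (f : V -> W -> U) (t : tensor V W) : U :=
  \sum_i \sum_j t i j *: f (vbasis {:V})`_i (vbasis {:W})`_j.

Definition tensv (A : {vspace V}) (B : {vspace W}) : {vspace tensor V W} :=
  <<[seq tens a b | a <- vbasis A, b <- vbasis B]>>%VS.

Lemma tlift_is_linear (U : lmodType K) (f : V -> W -> U) : linear (tlift f).
Proof.
move=> c s t; rewrite /tlift scaler_sumr -big_split /=.
apply: eq_bigr => i _; rewrite scaler_sumr -big_split /=.
by apply: eq_bigr => j _; rewrite !mxE scalerDl scalerA.
Qed.

HB.instance Definition _ (U : lmodType K) (f : V -> W -> U) :=
  GRing.isLinear.Build K (tensor V W) U _ (tlift f) (tlift_is_linear f).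

Lemma tens_linearl w : linear (tens^~ w).
Proof.
by move=> c u v; apply/matrixP=> i j; rewrite !mxE linearP mulrDl -mulrA.
Qed.

Lemma tens_linearr v : linear (tens v).
Proof.
move=> c u w; apply/matrixP=> i j; rewrite !mxE linearP mulrDr /=.
by rewrite mulrCA.
Qed.

Lemma tlift_tens (U : lmodType K) (f : V -> W -> U) v w :
    (forall w, linear (f^~ w)) -> (forall v, linear (f v)) ->
  tlift f (tens v w) = f v w.
Proof.
move=> fl fr.
pose Fl w' : {linear V -> U} :=
  HB.pack (f^~ w') (GRing.isLinear.Build _ _ _ _ _ (fl w')).
pose Fr v' : {linear W -> U} :=
  HB.pack (f v') (GRing.isLinear.Build _ _ _ _ _ (fr v')).
rewrite -[RHS]/(Fl w v) {2}(coord_vbasis (memvf v)) linear_sum.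
apply: eq_bigr => i _; rewrite linearZ /=.
rewrite -[f _ w]/(Fr _ w) {2}(coord_vbasis (memvf w)) linear_sum scaler_sumr.
by apply: eq_bigr => j _; rewrite linearZ /= mxE scalerA.
Qed.

Lemma memv_tens (A : {vspace V}) (B : {vspace W}) a b :
  a \in A -> b \in B -> tens a b \in tensv A B.
Proof.
move=> Aa Bb.
pose Fl w' : {linear V -> tensor V W} :=
  HB.pack (tens^~ w') (GRing.isLinear.Build _ _ _ _ _ (tens_linearl w')).
pose Fr v' : {linear W -> tensor V W} :=
  HB.pack (tens v') (GRing.isLinear.Build _ _ _ _ _ (tens_linearr v')).
rewrite -[tens a b]/(Fl b a) (coord_vbasis Aa) linear_sum.
apply: memv_suml => i _; rewrite linearZ /= memvZ //.
rewrite -[tens _ b]/(Fr _ b) (coord_vbasis Bb) linear_sum.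
apply: memv_suml => j _; rewrite linearZ /= memvZ //.
by apply/memv_span/allpairs_f; rewrite mem_nth ?size_tuple.
Qed.

End Tensor.

HB.mixin Record Vector_isCoalgebra (K : fieldType) C of Vector K C := {
  comul : 'Hom(C, tensor C C);
  counit : 'Hom(C, K^o);
  comulA : forall x : C,
    tlift (fun x1 x2 => tens (comul x1) x2) (comul x) =
    tlift (fun x1 y => tlift (fun x2 x3 => tens (tens x1 x2) x3) (comul y))
      (comul x);
  counitl : forall x : C, tlift (fun x1 x2 => (counit x1 : K) *: x2) (comul x) = x;
  counitr : forall x : C, tlift (fun x1 x2 => (counit x2 : K) *: x1) (comul x) = x
}.

#[short(type="coalgType")]
HB.structure Definition Coalgebra (K : fieldType) :=
  { C of Vector_isCoalgebra K C & Vector K C }.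

(* Sweedler's notation: the sum f(x_1, x_2), where comul x is the sum of the  *)
(* x_1 (x) x_2.                                                               *)
Definition sweedler (K : fieldType) (C : coalgType K) (U : lmodType K)
  (x : C) (f : C -> C -> U) : U := tlift f (comul x).

HB.mixin Record Coalgebra_isHopf (K : fieldType) H
    of Falgebra K H & Coalgebra K H := {
  comul1 : comul (1 : H) = tens 1 1;
  comulM : forall x y : H,
    comul (x * y) =
    sweedler x (fun x1 x2 => sweedler y (fun y1 y2 => tens (x1 * y1) (x2 * y2)));
  counit1 : counit (1 : H) = 1;
  counitM : forall x y : H, counit (x * y) = counit x * counit y;
  antipode : 'End(H);
  antipodel : forall x : H,
    sweedler x (fun x1 x2 => antipode x1 * x2) = (counit x : K) *: (1 : H);
  antipoder : forall x : H,
    sweedler x (fun x1 x2 => x1 * antipode x2) = (counit x : K) *: (1 : H)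
}.

(* Finite-dimensional Hopf algebras.                                          *)
#[short(type="hopfType")]
HB.structure Definition Hopf (K : fieldType) :=
  { H of Coalgebra_isHopf K H & Falgebra K H & Coalgebra K H }.

Section Cosemisimple.

Variables (K : fieldType) (C : coalgType K).

Definition subcoalgebra (D : {vspace C}) : Prop :=
  (comul @: D <= tensv D D)%VS.

Definition simple_subcoalgebra (D : {vspace C}) : Prop :=
  [/\ subcoalgebra D, D <> 0%VS &
      forall E : {vspace C},
        subcoalgebra E -> (E <= D)%VS -> E = 0%VS \/ E = D].

Definition cosemisimple : Prop :=
  exists (n : nat) (D : 'I_n -> {vspace C}),
    [/\ forall i, simple_subcoalgebra (D i), directv (\sum_i D i)
      & (\sum_i D i)%VS = fullv].

End Cosemisimple.

Section PartialAction.

Variables (K : fieldType) (H : hopfType K).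

Definition partial_action (lambda : 'Hom(H, K^o)) : Prop :=
  lambda 1 = 1 /\
  forall h k : H,
    lambda h * lambda k = sweedler h (fun h1 h2 => lambda h1 * lambda (h2 * k)).

Definition smash_map (lambda : 'Hom(H, K^o)) (h : H) : H :=
  sweedler h (fun h1 h2 => (lambda h1 : K) *: h2).

Lemma smash_map_is_linear lambda : linear (smash_map lambda).
Proof. by move=> c x y; rewrite /smash_map /sweedler !linearP. Qed.

HB.instance Definition _ lambda :=
  GRing.isLinear.Build K H H _ (smash_map lambda) (smash_map_is_linear lambda).

Definition Hlambda (lambda : 'Hom(H, K^o)) : {vspace H} :=
  limg (linfun (smash_map lambda)).

Lemma HlambdaP (lambda : 'Hom(H, K^o)) (x : H) :
  reflect (exists h : H, x = sweedler h (fun h1 h2 => (lambda h1 : K) *: h2))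
          (x \in Hlambda lambda).
Proof.
apply: (iffP memv_imgP) => [[h _ ->]|[h ->]]; exists h; rewrite ?memvf ?lfunE //.
Qed.

(* {aspace H} is not used here, as its elements need not contain 1.           *)
Definition right_coideal_subalgebra (B : {vspace H}) : Prop :=
  [/\ 1 \in B, (B * B <= B)%VS & (comul @: B <= tensv B {:H})%VS].

End PartialAction.

(* Main.v *)
(* An idempotent lambda in the convolution algebra H^* is a partial action iff
   E(h) = lambda(h_1) h_2 is a left B-linear, right H-colinear projection of H
   onto B := H_lambda, and then lambda = eps o E. Let phi be the normalized
   two-sided integral on H, which exists by cosemisimplicity. Given B, the
   projection E is the conditional expectation defined by
   phi(b E(h)) = phi(b h) for b in B; it exists as soon as phi is nondegenerate
   on B.

   Both nondegeneracy and uniqueness rest on S^2 = 1. When S^2 = 1, left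
   multiplication by b on B has trace dim(B) phi(b), so that the radical of phi
   on B, a left ideal and right coideal, has nilpotent elements; eps vanishes on
   it, hence it is 0. Moreover lambda = lambda * (lambda o S), so
   lambda o S = lambda, and H_lambda = H_mu gives lambda * mu = lambda and
   mu * lambda = mu, whence lambda = mu on applying S.

   For S^2 = 1, decompose H into simple comatrix coalgebras c_i, on which S^2 is
   conjugation by a matrix F_i of trace 1, and put t_i = tr(F_i^-1). The
   Nakayama automorphism of phi yields a character alpha of H with
   alpha(c_i) = t_i F_i^2; it has finite order, so the trace T = sum_i t_i of
   S^-2 is, up to transfer to the algebraic complex numbers, a sum of squared
   moduli of sums of roots of unity, hence nonzero. As T phi(h) is the trace of
   S^-2 composed with the left multiplication by h, this makes S^-2 the Nakayama
   automorphism, so that t_i F_i^2 = 1 and S^4 = 1. Finally the character x of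
   the regular comodule satisfies x^2 = dim(H) x, S^2(x) = x and phi(x) = 1, so
   T is dim(H) times an integer, and a nonzero trace of an involution fixing 1
   with this property forces S^2 = 1. *)

From HB Require Import structures.
From Stdlib Require Import Classical.
Require Import Defs.
From mathcomp Require Import all_boot all_order all_algebra all_solvable all_field.

Set Implicit Arguments.
Unset Strict Implicit.
Unset Printing Implicit Defensive.

Import GRing.Theory.
Local Open Scope ring_scope.

(** * Tensors and comatrices *)

Definition bilin (K : fieldType) (V W : vectType K) (U : lmodType K)
  (f : V -> W -> U) : Prop :=
  (forall w, linear (f^~ w)) /\ (forall v, linear (f v)).

Lemma sum_delta (K : pzRingType) (V : lmodType K) m (F : 'I_m -> V) (i : 'I_m) :
  \sum_k ((k == i)%:R : K) *: F k = F i.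
Proof.
rewrite (bigD1 i) //= eqxx scale1r big1 ?addr0 // => k ki.
by rewrite (negPf ki) scale0r.
Qed.

Lemma tlift_linear_fun (K : fieldType) (V W : vectType K) (T U : lmodType K)
    (f : T -> V -> W -> U) (t : tensor V W) :
  (forall a b, linear (fun z => f z a b)) -> linear (fun z => tlift (f z) t).
Proof.
move=> fl c x y; rewrite /tlift scaler_sumr -big_split; apply: eq_bigr => a _ /=.
rewrite scaler_sumr -big_split; apply: eq_bigr => b _ /=.
by rewrite fl scalerDr !scalerA mulrC.
Qed.

Section TensorExtra.

Variables (K : fieldType) (V W : vectType K).
Implicit Types (U : lmodType K).

Lemma tens_bilinear : bilin (@tens K V W).
Proof. by split=> ?; [apply: tens_linearl | apply: tens_linearr]. Qed.

Lemma bilin_suml U (f : V -> W -> U) I (r : seq I) (P : pred I) (F : I -> V) w :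
  bilin f -> f (\sum_(i <- r | P i) F i) w = \sum_(i <- r | P i) f (F i) w.
Proof.
case=> fl _; pose g : {linear V -> U} :=
  HB.pack (f^~ w) (GRing.isLinear.Build _ _ _ _ _ (fl w)).
exact: (linear_sum g).
Qed.

Lemma bilin_sumr U (f : V -> W -> U) I (r : seq I) (P : pred I) (F : I -> W) v :
  bilin f -> f v (\sum_(i <- r | P i) F i) = \sum_(i <- r | P i) f v (F i).
Proof.
case=> _ fr; pose g : {linear W -> U} :=
  HB.pack (f v) (GRing.isLinear.Build _ _ _ _ _ (fr v)).
exact: (linear_sum g).
Qed.

Lemma bilinZl U (f : V -> W -> U) a v w : bilin f -> f (a *: v) w = a *: f v w.
Proof.
case=> fl _; pose g : {linear V -> U} :=
  HB.pack (f^~ w) (GRing.isLinear.Build _ _ _ _ _ (fl w)).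
exact: (linearZ_LR g).
Qed.

Lemma bilinZr U (f : V -> W -> U) a v w : bilin f -> f v (a *: w) = a *: f v w.
Proof.
case=> _ fr; pose g : {linear W -> U} :=
  HB.pack (f v) (GRing.isLinear.Build _ _ _ _ _ (fr v)).
exact: (linearZ_LR g).
Qed.

Lemma tlift_bilin U (f : V -> W -> U) v w :
  bilin f -> tlift f (tens v w) = f v w.
Proof. by case=> fl fr; apply: tlift_tens. Qed.

Lemma tens_suml I (r : seq I) (P : pred I) (F : I -> V) (w : W) :
  tens (\sum_(i <- r | P i) F i) w = \sum_(i <- r | P i) tens (F i) w.
Proof. exact: (bilin_suml _ _ _ _ tens_bilinear). Qed.

Lemma tens_sumr I (r : seq I) (P : pred I) (F : I -> W) (v : V) :
  tens v (\sum_(i <- r | P i) F i) = \sum_(i <- r | P i) tens v (F i).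
Proof. exact: (bilin_sumr _ _ _ _ tens_bilinear). Qed.

Lemma tensZl a (v : V) (w : W) : tens (a *: v) w = a *: tens v w.
Proof. exact: (bilinZl _ _ _ tens_bilinear). Qed.

Lemma tensZr a (v : V) (w : W) : tens v (a *: w) = a *: tens v w.
Proof. exact: (bilinZr _ _ _ tens_bilinear). Qed.

Lemma tens0l (w : W) : tens (0 : V) w = 0.
Proof. by rewrite -(scale0r 0) tensZl scale0r. Qed.

Lemma tens0r (v : V) : tens v (0 : W) = 0.
Proof. by rewrite -(scale0r 0) tensZr scale0r. Qed.

(** Expanding first legs in the basis of [A] leaves second legs in [B]; this form turns a coaction
    into a matrix of coefficients. *)
Lemma tens_mem (A : {vspace V}) (B : {vspace W}) (t : tensor V W) :
  reflect (exists2 w : 'I_(\dim A) -> W, (forall i, w i \in B) &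
             t = \sum_(i < \dim A) tens (vbasis A)`_i (w i))
          (t \in tensv A B).
Proof.
apply: (iffP idP) => [tAB | [w wB ->]]; last first.
  apply: memv_suml => i _; apply: memv_tens => //.
  by rewrite vbasis_mem // mem_nth ?size_tuple.
have: exists c : 'I_(\dim A) -> 'I_(\dim B) -> K,
    t = \sum_(i < \dim A) \sum_(j < \dim B) c i j *: tens (vbasis A)`_i (vbasis B)`_j.
  have tE := @coord_span _ _ _ (in_tuple [seq tens a b | a <- vbasis A, b <- vbasis B]) t tAB.
  rewrite tE; elim/big_ind: _ => [|x y [c ->] [d ->]|k _].
  - by exists (fun _ _ => 0); rewrite big1 // => i _; rewrite big1 // => j _; rewrite scale0r.
  - exists (fun i j => c i j + d i j); rewrite -big_split /=.
    apply: eq_bigr => i _; rewrite -big_split /=.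
    by apply: eq_bigr => j _; rewrite scalerDl.
  - have /allpairsP[[a b] /= [aA bB ->]] :
      (in_tuple [seq tens a b | a <- vbasis A, b <- vbasis B])`_k
        \in [seq tens a b | a <- vbasis A, b <- vbasis B].
      by rewrite mem_nth.
    set x := coord _ _ _.
    exists (fun i j => x * coord (vbasis A) i a * coord (vbasis B) j b).
    rewrite {1}(coord_vbasis (vbasis_mem aA)) {1}(coord_vbasis (vbasis_mem bB)).
    rewrite tens_suml scaler_sumr; apply: eq_bigr => i _.
    rewrite tens_sumr scaler_sumr; apply: eq_bigr => j _.
    by rewrite tensZl tensZr !scalerA -?mulrA.
case=> c ->; exists (fun i => \sum_(j < \dim B) c i j *: (vbasis B)`_j).
  by move=> i; apply: memv_suml => j _; rewrite memvZ // vbasis_mem // mem_nth ?size_tuple.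
apply: eq_bigr => i _; rewrite tens_sumr; apply: eq_bigr => j _.
by rewrite tensZr.
Qed.

(** The $i$-th coordinate applied to first legs isolates the $i$-th second leg. It serves to compare
    coefficients in two expansions of the same comultiplication. *)
Lemma tensor_free n (v : n.-tuple V) (w1 w2 : 'I_n -> W) :
  free v -> \sum_(i < n) tens v`_i (w1 i) = \sum_(i < n) tens v`_i (w2 i) -> w1 =1 w2.
Proof.
move=> fv eq12 i.
have bl : bilin (fun (a : V) (b : W) => coord v i a *: b).
  split=> [w c x y|x c w w'] /=; first by rewrite linearP scalerDl scalerA.
  by rewrite scalerDr !scalerA mulrC.
have := congr1 (tlift (fun a b => coord v i a *: b)) eq12.
rewrite !linear_sum /=.
under eq_bigr do rewrite tlift_bilin // coord_free //.
under [X in _ = X]eq_bigr do rewrite tlift_bilin // coord_free //.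
by rewrite !sum_delta.
Qed.

End TensorExtra.

Lemma tensorE (K : fieldType) (V W : vectType K) (t : tensor V W) :
  t = \sum_(i < \dim {:V}) \sum_(j < \dim {:W})
        t i j *: tens (vbasis {:V})`_i (vbasis {:W})`_j.
Proof.
have fV : free (vbasis {:V}) := basis_free (vbasisP _).
have fW : free (vbasis {:W}) := basis_free (vbasisP _).
apply/matrixP=> a b; rewrite summxE (bigD1 a) //= summxE (bigD1 b) //=.
rewrite !mxE !coord_free // !eqxx !mulr1 big1 ?addr0 ?big1 ?addr0 // => c ca.
  rewrite summxE big1 // => d _; rewrite !mxE !coord_free //.
  by rewrite (negPf ca) mul0r mulr0.
by rewrite !mxE !coord_free // eqxx (negPf ca) !mulr0.
Qed.

Section Comatrices.

Variables (K : fieldType) (H : hopfType K).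
Implicit Types (U : lmodType K).

(** The [v i] carry a right coaction with matrix [D], read by columns. When [v] is a row of [D],
    this is the comultiplication of a matrix coalgebra. *)
Definition corow m (v : 'I_m -> H) (D : 'M[H]_m) : Prop :=
  forall i, comul (v i) = \sum_j tens (v j) (D j i).

Definition comatrix m (D : 'M[H]_m) : Prop :=
  (forall i, corow (D i) D) /\ (forall i j, counit (D i j) = (i == j)%:R).

Lemma sweedler_corow U m (v : 'I_m -> H) D (f : H -> H -> U) i :
  corow v D -> bilin f -> sweedler (v i) f = \sum_j f (v j) (D j i).
Proof.
move=> vD fb; rewrite /sweedler vD linear_sum /=.
by apply: eq_bigr => j _; rewrite tlift_bilin.
Qed.

Lemma comulM_corow m p (v : 'I_m -> H) D (w : 'I_p -> H) E i j :
  corow v D -> corow w E ->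
  comul (v i * w j) = \sum_k \sum_l tens (v k * w l) (D k i * E l j).
Proof.
move=> vD wE; rewrite comulM.
have bl1 x1 x2 : bilin (fun y1 y2 : H => tens (x1 * y1) (x2 * y2)).
  split=> [w'|v'] c x y /=.
    by rewrite mulrDr -scalerAr tens_linearl.
  by rewrite mulrDr -scalerAr tens_linearr.
rewrite (sweedler_corow _ vD); last first.
  split=> [w'|v']; apply: tlift_linear_fun => a b c x y.
    by rewrite mulrDl -scalerAl tens_linearl.
  by rewrite mulrDl -scalerAl tens_linearr.
by apply: eq_bigr => k _; rewrite (sweedler_corow _ wE).
Qed.

Lemma sweedlerM_corow U m p (v : 'I_m -> H) D (w : 'I_p -> H) E
    (f : H -> H -> U) i j :
  corow v D -> corow w E -> bilin f ->
  sweedler (v i * w j) f = \sum_k \sum_l f (v k * w l) (D k i * E l j).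
Proof.
move=> vD wE fb; rewrite /sweedler (comulM_corow _ _ vD wE) linear_sum.
apply: eq_bigr => k _; rewrite linear_sum.
by apply: eq_bigr => l _ /=; rewrite tlift_bilin.
Qed.

(** Coassociativity and the right counit axiom at $v_i$, compared at the coefficient of a free
    vector $v_l$, give the two comatrix axioms. *)
Lemma corow_comatrix n (v : n.-tuple H) D :
  free v -> corow (fun i : 'I_n => v`_i) D -> comatrix D.
Proof.
move=> fv vD.
split=> [|].
  move=> l i; have := comulA v`_i.
  have bl1 : bilin (fun x1 x2 : H => tens (comul x1) x2).
    split=> [w|u] c x y /=; last by rewrite tens_linearr.
    by rewrite linearP tens_linearl.
  have bl3 x1 : bilin (fun x2 x3 : H => tens (tens x1 x2) x3).
    split=> [w|u] c x y /=; last by rewrite tens_linearr.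
    by rewrite tens_linearr tens_linearl.
  have bl2 : bilin (fun x1 y : H => tlift (fun x2 x3 => tens (tens x1 x2) x3) (comul y)).
    split=> [w|u] c x y /=; last by rewrite !linearP.
    apply: (tlift_linear_fun (f := fun z x2 x3 => tens (tens z x2) x3)) => a b.
    by move=> d z z'; rewrite !tens_linearl.
  rewrite -!/(sweedler _ _) (sweedler_corow i vD bl1) (sweedler_corow i vD bl2).
  have bl5 : bilin (fun p q : H => coord v l p *: q).
    split=> [w|u] c x y /=; first by rewrite linearP scalerDl scalerA.
    by rewrite scalerDr !scalerA mulrC.
  (* This map sends $(p \otimes q) \otimes z$ to $c_l(p)\, q \otimes z$, where $c_l$ is the
     coordinate at $v_l$; applied to coassociativity it extracts the formula for
     $\Delta(D_{li})$. *)
  have bl4 : bilin (fun (t : tensor H H) (z : H) =>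
      tens (tlift (fun p q : H => coord v l p *: q) t) z).
    split=> [w|u] c x y /=; last by rewrite tens_linearr.
    by rewrite linearP tens_linearl.
  move/(congr1 (tlift (fun (t : tensor H H) (z : H) =>
      tens (tlift (fun p q : H => coord v l p *: q) t) z))).
  rewrite !linear_sum /= => eqA; apply/esym.
  have -> : comul (D l i) = \sum_(j < n) tlift (fun (t : tensor H H) (z : H) =>
      tens (tlift (fun p q : H => coord v l p *: q) t) z)
      (tlift (fun x2 x3 => tens (tens v`_j x2) x3) (comul (D j i))).
    have aux (j : 'I_n) : tlift (fun (t : tensor H H) (z : H) =>
        tens (tlift (fun p q : H => coord v l p *: q) t) z)
        (tlift (fun x2 x3 => tens (tens v`_j x2) x3) (comul (D j i)))
        = (l == j)%:R *: comul (D j i).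
      rewrite /(tlift (fun x2 x3 => _) _) linear_sum.
      rewrite [in RHS](tensorE (comul (D j i))) scaler_sumr; apply: eq_bigr => a _.
      rewrite linear_sum scaler_sumr; apply: eq_bigr => b _ /=.
      rewrite linearZ /= tlift_bilin // tlift_bilin // coord_free // tensZl.
      by rewrite !scalerA mulrC eq_sym.
    rewrite (eq_bigr _ (fun j _ => aux j)) (bigD1 l) //= eqxx scale1r big1 ?addr0 //.
    by move=> j jl; rewrite eq_sym (negPf jl) scale0r.
  rewrite -eqA; apply: eq_bigr => j _; rewrite tlift_bilin // vD linear_sum.
  rewrite (bigD1 l) //= tlift_bilin // coord_free // eqxx scale1r big1 ?addr0 //.
  by move=> k kl; rewrite tlift_bilin // coord_free // (negPf kl) scale0r.
move=> j i; have := counitr v`_i.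
have bl : bilin (fun x1 x2 : H => (counit x2 : K) *: x1).
  split=> [w|u] c x y /=; first by rewrite scalerDr !scalerA mulrC.
  by rewrite linearP scalerDl scalerA.
rewrite -!/(sweedler _ _) (sweedler_corow i vD bl) => /(congr1 (coord v j)).
rewrite linear_sum (bigD1 j) //= linearZ /= !coord_free // eqxx mulr1 big1 ?addr0.
  by move=> ->; rewrite eq_sym.
by move=> k kj; rewrite linearZ /= coord_free // (negPf kj) mulr0.
Qed.

(** It is used with [B] the whole space for a right coideal [A], and with [B] equal to [A] for a
    subcoalgebra, whose matrix coefficients then stay inside it. *)
Lemma coideal_comatrix (A B : {vspace H}) :
  (comul @: A <= tensv A B)%VS ->
  exists D : 'M[H]_(\dim A),
    [/\ corow (fun i : 'I_(\dim A) => (vbasis A)`_i) D, comatrix D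
      & forall i j, D i j \in B].
Proof.
move=> AB.
have h i : exists w : {ffun 'I_(\dim A) -> H}, (forall j, w j \in B) /\
    comul (vbasis A)`_i = \sum_(j < \dim A) tens (vbasis A)`_j (w j).
  have : comul (vbasis A)`_i \in tensv A B.
    case: (ltnP i (\dim A)) => iA; last first.
      by rewrite nth_default ?size_tuple // linear0 mem0v.
    by apply: (subvP AB); rewrite memv_img // vbasis_mem // mem_nth ?size_tuple.
  case/tens_mem=> w wB ->; exists (finfun w); split=> [j|]; rewrite ?ffunE //.
  by apply: eq_bigr => j _; rewrite ffunE.
have [w wP] := fin_all_exists (fun i : 'I_(\dim A) => h i).
have vD : corow (fun i : 'I_(\dim A) => (vbasis A)`_i) (\matrix_(i, j) w j i).
  by move=> i; rewrite (wP i).2; apply: eq_bigr => j _; rewrite mxE.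
exists (\matrix_(i, j) w j i); split=> //.
  exact: corow_comatrix (basis_free (vbasisP A)) vD.
by move=> i j; rewrite mxE (wP j).1.
Qed.

End Comatrices.

(** * The antipode *)

Section Antipode.

Variables (K : fieldType) (H : hopfType K).
Implicit Types (U : lmodType K).

Lemma tensv_full : tensv {:H} {:H} = fullv.
Proof.
apply/eqP; rewrite eqEsubv subvf; apply/subvP=> t _; rewrite (tensorE t).
apply: memv_suml => i _; apply: memv_suml => j _; rewrite memvZ //.
by rewrite memv_tens ?memvf.
Qed.

Lemma sweedler_counitl (x : H) :
  sweedler x (fun x1 x2 => (counit x1 : K) *: x2) = x.
Proof. exact: counitl. Qed.

Lemma counit_bilinear : bilin (fun x1 x2 : H => (counit x1 : K) *: x2).
Proof.
split=> [w|u] c x y /=; first by rewrite linearP scalerDl scalerA.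
by rewrite scalerDr !scalerA mulrC.
Qed.

Lemma comatrix1 : comatrix (1%:M : 'M[H]_1).
Proof.
split=> i j; rewrite ?[i]ord1 ?[j]ord1 ?mxE ?eqxx ?counit1 //.
by rewrite big_ord1 comul1 !mxE.
Qed.

(** The counit gives $b_i = \sum_j \varepsilon(b_j) C_{ji}$ for the matrix $C$ of the regular
    comodule, so its entries span $H$. Linear identities can thus be checked on entries of
    comatrices, where Sweedler sums become matrix products. *)
Lemma comatrix_ind (P : H -> Prop) :
  (forall c x y, P x -> P y -> P (c *: x + y)) ->
  (forall m (D : 'M[H]_m), comatrix D -> forall i j, P (D i j)) ->
  forall x, P x.
Proof.
move=> Plin PD; have := @coideal_comatrix K H {:H} {:H}.
rewrite tensv_full subvf => -[//|C [bC cC _]] x.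
have P0 : P 0.
  have P1 := PD _ _ comatrix1 ord0 ord0.
  by have := Plin (-1) _ _ P1 P1; rewrite scaleN1r addNr.
have Psum I (r : seq I) (F : I -> H) : (forall i, P (F i)) -> P (\sum_(i <- r) F i).
  by move=> PF; elim/big_ind: _ => // a b Pa Pb; rewrite -[a]scale1r; apply: Plin.
have PZ c y : P y -> P (c *: y) by move=> Py; rewrite -[c *: y]addr0; apply: Plin.
rewrite (coord_vbasis (memvf x)); apply: (Psum) => i; apply: (PZ).
rewrite -[(vbasis _)`_i]sweedler_counitl (sweedler_corow i bC counit_bilinear).
by apply: (Psum) => j; apply: (PZ); apply: PD.
Qed.

Lemma sweedler_comatrix U m (D : 'M[H]_m) (f : H -> H -> U) i j :
  comatrix D -> bilin f -> sweedler (D i j) f = \sum_k f (D i k) (D k j).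
Proof. by case=> rD _ fb; rewrite (sweedler_corow j (rD i)). Qed.

Lemma comul_comatrix m (D : 'M[H]_m) i j :
  comatrix D -> comul (D i j) = \sum_k tens (D i k) (D k j).
Proof. by case=> rD _; rewrite rD. Qed.

Lemma mul_antipodel m (D : 'M[H]_m) :
  comatrix D -> map_mx antipode D *m D = 1%:M.
Proof.
move=> cD; apply/matrixP=> i j; rewrite !mxE; under eq_bigr do rewrite mxE.
have bl : bilin (fun x1 x2 : H => antipode x1 * x2).
  split=> [w|u] c x y /=; first by rewrite linearP mulrDl scalerAl.
  by rewrite mulrDr scalerAr.
have := antipodel (D i j); rewrite (sweedler_comatrix i j cD bl) cD.2.
by move=> ->; case: (i == j); rewrite ?scale1r ?scale0r.
Qed.

Lemma mul_antipoder m (D : 'M[H]_m) :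
  comatrix D -> D *m map_mx antipode D = 1%:M.
Proof.
move=> cD; apply/matrixP=> i j; rewrite !mxE; under eq_bigr do rewrite mxE.
have bl : bilin (fun x1 x2 : H => x1 * antipode x2).
  split=> [w|u] c x y /=; first by rewrite mulrDl scalerAl.
  by rewrite linearP mulrDr scalerAr.
have := antipoder (D i j); rewrite (sweedler_comatrix i j cD bl) cD.2.
by move=> ->; case: (i == j); rewrite ?scale1r ?scale0r.
Qed.

Lemma sum_antipodel m (D : 'M[H]_m) i j :
  comatrix D -> \sum_k antipode (D i k) * D k j = (i == j)%:R.
Proof.
move/mul_antipodel/matrixP/(_ i j); rewrite !mxE => <-.
by apply: eq_bigr => k _; rewrite mxE.
Qed.

Lemma sum_antipoder m (D : 'M[H]_m) i j :
  comatrix D -> \sum_k D i k * antipode (D k j) = (i == j)%:R.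
Proof.
move/mul_antipoder/matrixP/(_ i j); rewrite !mxE => <-.
by apply: eq_bigr => k _; rewrite mxE.
Qed.

Lemma sum_mull_delta (R : pzRingType) m (F : 'I_m -> R) (i : 'I_m) :
  \sum_k (k == i)%:R * F k = F i.
Proof.
rewrite (bigD1 i) //= eqxx mul1r big1 ?addr0 // => k ki.
by rewrite (negPf ki) mul0r.
Qed.

Lemma sum_mulr_delta (R : pzRingType) m (F : 'I_m -> R) (i : 'I_m) :
  \sum_k F k * (k == i)%:R = F i.
Proof.
rewrite (bigD1 i) //= eqxx mulr1 big1 ?addr0 // => k ki.
by rewrite (negPf ki) mulr0.
Qed.

(** Both $S(xy)$ and $S(y)S(x)$ are convolution inverse to the multiplication $H \otimes H \to H$:
    [left] makes the first a left inverse and [right] makes the second a right inverse, so they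
    agree. *)
Lemma antipodeM (x y : H) : antipode (x * y) = antipode y * antipode x.
Proof.
move: x; apply: comatrix_ind => [c a b Pa Pb|m D cD i j].
  by rewrite mulrDl -scalerAl !linearP /= Pa Pb mulrDr -scalerAr.
move: y; apply: comatrix_ind => [c a b Pa Pb|p E cE k l].
  by rewrite mulrDr -scalerAr !linearP /= Pa Pb mulrDl -scalerAl.
have bl : bilin (fun x1 x2 : H => antipode x1 * x2).
  split=> [w|u] c x y /=; first by rewrite linearP mulrDl scalerAl.
  by rewrite mulrDr scalerAr.
have left c d : \sum_a \sum_b antipode (D i a * E k b) * (D a c * E b d) =
    (i == c)%:R * (k == d)%:R.
  have := antipodel (D i c * E k d).
  rewrite (sweedlerM_corow _ _ (cD.1 i) (cE.1 k) bl) => ->.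
  rewrite counitM cD.2 cE.2.
  by case: (i == c); case: (k == d); rewrite ?mulr0 ?mul0r ?mulr1 ?scale1r ?scale0r.
have right a b : \sum_c \sum_d (D a c * E b d) *
    (antipode (E d l) * antipode (D c j)) = (b == l)%:R * (a == j)%:R.
  rewrite -(sum_antipoder b l cE) -(sum_antipoder a j cD) mulr_sumr.
  apply: eq_bigr => c _; rewrite (sum_antipoder b l cE).
  have -> : (b == l)%:R * (D a c * antipode (D c j)) =
            D a c * (b == l)%:R * antipode (D c j).
    by case: (b == l); rewrite ?mulr0 ?mul0r ?mulr1 ?mul1r.
  rewrite -(sum_antipoder b l cE) mulr_sumr mulr_suml.
  by apply: eq_bigr => d _; rewrite !mulrA.
transitivity (\sum_a \sum_b antipode (D i a * E k b) *
    \sum_c \sum_d (D a c * E b d) * (antipode (E d l) * antipode (D c j))).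
  rewrite (bigD1 j) //= (bigD1 l) //= right !eqxx !mulr1 !big1 ?addr0 //.
    by move=> a aj; rewrite big1 // => b _; rewrite right (negPf aj) !mulr0.
  by move=> b bl'; rewrite right (negPf bl') mul0r mulr0.
transitivity (\sum_c \sum_d (i == c)%:R * (k == d)%:R *
   (antipode (E d l) * antipode (D c j))).
  under eq_bigr => a _ do under eq_bigr => b _ do rewrite mulr_sumr.
  under eq_bigr => a _ do rewrite exchange_big.
  rewrite exchange_big; apply: eq_bigr => c _ /=.
  under eq_bigr => a _ do under eq_bigr => b _ do rewrite mulr_sumr.
  under eq_bigr => a _ do rewrite exchange_big.
  rewrite exchange_big; apply: eq_bigr => d _ /=.
  rewrite -left mulr_suml; apply: eq_bigr => a _; rewrite mulr_suml.
  by apply: eq_bigr => b _; rewrite !mulrA.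
rewrite (bigD1 i) //= (bigD1 k) //= !eqxx !mul1r !big1 ?addr0 //.
  by move=> a aj; rewrite big1 // => b _; rewrite eq_sym (negPf aj) !mul0r.
by move=> b bl'; rewrite [k == b]eq_sym (negPf bl') mulr0 mul0r.
Qed.

(** The product of the tensor product algebra $H \otimes H$. *)
Definition tmul (t u : tensor H H) : tensor H H :=
  tlift (fun a b => tlift (fun c d => tens (a * c) (b * d)) u) t.

Lemma tmul_bilinear : bilin tmul.
Proof.
split=> [u|t] c x y; first by rewrite /tmul linearP.
by apply: (tlift_linear_fun (f := fun u a b => tlift _ u)) => a b d z z'; rewrite linearP.
Qed.

Lemma tmul_tens a b c d : tmul (tens a b) (tens c d) = tens (a * c) (b * d).
Proof.
have bl1 x1 x2 : bilin (fun y1 y2 : H => tens (x1 * y1) (x2 * y2)).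
  split=> [w'|v'] e x y /=.
    by rewrite mulrDr -scalerAr tens_linearl.
  by rewrite mulrDr -scalerAr tens_linearr.
rewrite /tmul tlift_bilin ?tlift_bilin //.
split=> [w'|v']; apply: tlift_linear_fun => i j e x y.
  by rewrite mulrDl -scalerAl tens_linearl.
by rewrite mulrDl -scalerAl tens_linearr.
Qed.

Lemma tensor_ind (P : tensor H H -> Prop) :
  (forall c x y, P x -> P y -> P (c *: x + y)) ->
  (forall a b, P (tens a b)) -> forall t, P t.
Proof.
move=> Plin Pt t.
have P0 : P 0.
  by have := Plin (-1) _ _ (Pt 1 1) (Pt 1 1); rewrite scaleN1r addNr.
have Psum I (r : seq I) F : (forall i, P (F i)) -> P (\sum_(i <- r) F i).
  by move=> PF; elim/big_ind: _ => // a b Pa Pb; rewrite -[a]scale1r; apply: Plin.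
rewrite (tensorE t); apply: (Psum) => i; apply: (Psum) => j.
by rewrite -[_ *: _]addr0; apply: Plin.
Qed.

Lemma tmulA t u w : tmul t (tmul u w) = tmul (tmul t u) w.
Proof.
have [tl tr] := tmul_bilinear.
move: t; apply: tensor_ind => [c x y Px Py|a b]; first by rewrite !tl Px Py.
move: u; apply: tensor_ind => [c x y Px Py|a' b'].
  by rewrite tl !tr tl Px Py.
move: w; apply: tensor_ind => [c x y Px Py|a'' b'']; first by rewrite !tr Px Py.
by rewrite !tmul_tens !mulrA.
Qed.

Lemma comulM_tmul (x y : H) : comul (x * y) = tmul (comul x) (comul y).
Proof. exact: comulM. Qed.

Lemma tmul_unitl t : tmul (tens 1 1) t = t.
Proof.
move: t; apply: tensor_ind => [c x y Px Py|a b].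
  by rewrite tmul_bilinear.2 Px Py.
by rewrite tmul_tens !mul1r.
Qed.

Lemma tmul_unitr t : tmul t (tens 1 1) = t.
Proof.
move: t; apply: tensor_ind => [c x y Px Py|a b].
  by rewrite tmul_bilinear.1 Px Py.
by rewrite tmul_tens !mulr1.
Qed.

(** Convolution inverses again, now of $\Delta$ among maps $H \to H \otimes H$: $\Delta \circ S$ is
    a left inverse, and [Y], the flipped $(S \otimes S)\Delta$, is a right inverse. *)
Lemma comul_antipode m (D : 'M[H]_m) i j : comatrix D ->
  comul (antipode (D i j)) = \sum_k tens (antipode (D k j)) (antipode (D i k)).
Proof.
move=> cD; have tb := tmul_bilinear.
pose Y a b := \sum_k tens (antipode (D k b)) (antipode (D a k)).
have left a b : \sum_k tmul (comul (antipode (D a k))) (comul (D k b)) =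
    (a == b)%:R *: tens 1 1.
  under eq_bigr do rewrite -comulM_tmul.
  rewrite -linear_sum /= (sum_antipodel a b cD) -comul1.
  by case: (a == b); rewrite ?scale1r ?scale0r ?linear0.
have right a b : \sum_k tmul (comul (D a k)) (Y k b) = (a == b)%:R *: tens 1 1.
  transitivity (\sum_c tens (D a c * antipode (D c b)) (1 : H)).
    under eq_bigr do rewrite (comul_comatrix _ _ cD) (bilin_suml _ _ _ _ tb).
    rewrite exchange_big; apply: eq_bigr => c _ /=.
    under eq_bigr => k _ do rewrite (bilin_sumr _ _ _ _ tb).
    rewrite exchange_big (bigD1 c) //= [X in _ + X]big1 ?addr0 => [|d dc].
      under eq_bigr => k _ do rewrite tmul_tens.
      by rewrite -tens_sumr (sum_antipoder c c cD) eqxx.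
    under eq_bigr => k _ do rewrite tmul_tens.
    rewrite -tens_sumr (sum_antipoder c d cD) eq_sym (negPf dc).
    by rewrite tens0r.
  rewrite -tens_suml (sum_antipoder a b cD).
  by case: (a == b); rewrite ?scale1r // scale0r tens0l.
transitivity (\sum_k tmul (comul (antipode (D i k)))
    (\sum_l tmul (comul (D k l)) (Y l j))).
  under eq_bigr => k _ do rewrite right (bilinZr _ _ _ tb) tmul_unitr.
  by rewrite sum_delta.
under eq_bigr => k _ do rewrite (bilin_sumr _ _ _ _ tb).
rewrite exchange_big /=.
transitivity (\sum_l ((l == i)%:R : K) *: Y l j); last by rewrite sum_delta.
apply: eq_bigr => l _; under eq_bigr do rewrite tmulA.
by rewrite -(bilin_suml _ _ _ _ tb) left (bilinZl _ _ _ tb) tmul_unitl eq_sym.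
Qed.

Lemma counit_antipode (x : H) : counit (antipode x) = counit x.
Proof.
move: x; apply: comatrix_ind => [c x y Px Py|m D cD i j].
  by rewrite !linearP /= Px Py.
have := congr1 counit (sum_antipoder i j cD); rewrite linear_sum /=.
under eq_bigr do rewrite counitM cD.2.
rewrite (eq_bigr (fun k => ((k == i)%:R : K) *: (counit (antipode (D k j)) : K^o))).
  rewrite sum_delta cD.2 => ->.
  by case: (i == j); rewrite ?linear0 // counit1.
by move=> k _; rewrite eq_sym.
Qed.

Lemma comatrix_antipode m (D : 'M[H]_m) :
  comatrix D -> comatrix (map_mx antipode D)^T.
Proof.
move=> cD; split=> [i j|i j].
  rewrite !mxE (comul_antipode _ _ cD); apply: eq_bigr => k _.
  by rewrite !mxE.
by rewrite !mxE counit_antipode cD.2 eq_sym.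
Qed.

Lemma comatrix_antipode2 m (D : 'M[H]_m) :
  comatrix D -> comatrix (map_mx (fun x => antipode (antipode x)) D).
Proof.
move=> cD; have := comatrix_antipode (comatrix_antipode cD).
by congr comatrix; apply/matrixP=> i j; rewrite !mxE.
Qed.

Lemma antipode1 : antipode (1 : H) = 1.
Proof.
by have := sum_antipodel ord0 ord0 comatrix1; rewrite big_ord1 !mxE mulr1.
Qed.

End Antipode.

(** * Integrals *)

Lemma tens_eq0 (K : fieldType) (V W : vectType K) (v : V) (w : W) :
  tens v w = 0 -> v = 0 \/ w = 0.
Proof.
move=> vw0; case: (v =P 0) => [|/eqP v0]; first by left.
right; rewrite (coord_vbasis (memvf w)) big1 // => j _.
have [i ci] : exists i, coord (vbasis {:V}) i v != 0.
  apply/existsP; apply: contraNT v0; rewrite negb_exists => /forallP c0.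
  rewrite (coord_vbasis (memvf v)) big1 // => i _.
  by rewrite (eqP (negbNE (c0 i))) scale0r.
have /matrixP/(_ i j)/eqP := vw0.
by rewrite !mxE mulf_eq0 (negPf ci) /= => /eqP ->; rewrite scale0r.
Qed.

Lemma directv_projections (K : fieldType) (V : vectType K) n
    (D : 'I_n -> {vspace V}) :
  directv (\sum_i D i) -> (\sum_i D i)%VS = fullv ->
  exists pi : 'I_n -> 'End(V),
    [/\ forall i x, pi i x \in D i, forall x, \sum_i pi i x = x
      & forall i j x, x \in D j -> pi i x = if i == j then x else 0].
Proof.
move=> dD fD; exists (fun i => sumv_pi (\sum_i D i)%VS i).
have piD i x : sumv_pi (\sum_i D i)%VS i x \in D i by apply: memv_sum_pi.
have sumpi x : \sum_i sumv_pi (\sum_i D i)%VS i x = x.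
  by apply: sumv_pi_sum; rewrite fD memvf.
split=> // i j x xD; pose v k := if k == j then x else 0.
have sumv : \sum_k v k = x.
  by rewrite (bigD1 j) //= /v eqxx big1 ?addr0 // => k /negPf->.
have vD k : v k \in D k by rewrite /v; case: eqP => [->|_]; rewrite ?mem0v.
have := directv_sum_unique dD (fun k => sumv_pi (\sum_i D i)%VS k x) v
          (fun k _ => piD k x) (fun k _ => vD k).
by rewrite sumpi sumv eqxx => /esym/forallP/(_ i)/eqP.
Qed.

Section Integral.

Variables (K : fieldType) (H : hopfType K).

Definition integral (phi : 'Hom(H, K^o)) : Prop :=
  [/\ phi 1 = 1,
      forall x : H, sweedler x (fun x1 x2 => (phi x1 : K) *: x2) = (phi x : K) *: 1
    & forall x : H, sweedler x (fun x1 x2 => (phi x2 : K) *: x1) = (phi x : K) *: 1].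

Lemma functional_bilinl (f : 'Hom(H, K^o)) : bilin (fun x1 x2 : H => (f x1 : K) *: x2).
Proof.
split=> [w|u] c x y /=; first by rewrite linearP scalerDl scalerA.
by rewrite scalerDr !scalerA mulrC.
Qed.

Lemma functional_bilinr (f : 'Hom(H, K^o)) : bilin (fun x1 x2 : H => (f x2 : K) *: x1).
Proof.
split=> [w|u] c x y /=; last by rewrite linearP scalerDl scalerA.
by rewrite scalerDr !scalerA mulrC.
Qed.

(** Let $d_i$ be the components of $1$. As $\Delta(1) = 1 \otimes 1$ and each $\Delta(d_k)$ stays in
    $D_k \otimes D_k$, one gets $d_i \otimes d_j = 0$ for $i \ne j$. Hence $1$ lies in a single
    $D_i$, which is the line it spans by simplicity. *)
Lemma unit_simple_subcoalgebra n (D : 'I_n -> {vspace H}) :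
  (forall i, simple_subcoalgebra (D i)) -> directv (\sum_i D i) ->
  (\sum_i D i)%VS = fullv -> exists i, D i = <[1]>%VS.
Proof.
move=> sD dD fD.
have [pi [piD sumpi pi_id]] := directv_projections dD fD.
pose p2 i j := tlift (fun a b => tens (pi i a) (pi j b)).
have p2E i j a b : p2 i j (tens a b) = tens (pi i a) (pi j b).
  rewrite /p2 tlift_bilin //; split=> [w|u] c x y /=.
    by rewrite linearP tens_linearl.
  by rewrite linearP tens_linearr.
pose d i := pi i 1.
have p2d i j k : i != j -> p2 i j (comul (d k)) = 0.
  move=> ij; have [sub _ _] := sD k.
  have : comul (d k) \in tensv (D k) (D k).
    by apply: (subvP sub); rewrite memv_img ?piD.
  case/tens_mem=> w wD ->; rewrite /p2 linear_sum big1 // => a _ /=.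
  rewrite -/(p2 i j _) p2E (pi_id _ k) ?(pi_id _ k) ?wD //; last first.
    by rewrite vbasis_mem // mem_nth ?size_tuple.
  have [ik|_] := eqVneq i k; last by rewrite tens0l.
  by have [jk|_] := eqVneq j k; [rewrite ik jk eqxx in ij | rewrite tens0r].
have dd i j : i != j -> tens (d i) (d j) = 0.
  move=> ij; rewrite -p2E -comul1 -(sumpi 1) linear_sum /= /p2 linear_sum big1 //.
  by move=> k _; apply: p2d.
have [i di0] : exists i, d i != 0.
  apply/existsP; apply: contraT; rewrite negb_exists => /forallP d0.
  rewrite -(oner_eq0 H) -(sumpi 1) big1 // => i _.
  by have := d0 i; rewrite negbK => /eqP.
have di1 : d i = 1.
  rewrite -(sumpi 1) (bigD1 i) //= big1 ?addr0 // => j ji.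
  have /tens_eq0[/eqP|] := dd _ _ ji; last by move/eqP; rewrite (negPf di0).
  by move/eqP.
exists i; have [_ Dn0 /(_ <[1]>%VS)] := sD i; case.
- rewrite /subcoalgebra limg_line comul1 -memvE memv_tens ?memv_line //.
- by rewrite -memvE -di1 piD.
- by move/eqP; rewrite -dimv_eq0 dim_vline oner_neq0.
- by move->.
Qed.

(** The integral is the counit composed with the projection onto the summand spanned by $1$. It
    kills every other summand, hence also both legs of the comultiplication there. *)
Lemma integral_exists : cosemisimple H -> exists phi, integral phi.
Proof.
case=> n [D [sD dD fD]]; have [i Di] := unit_simple_subcoalgebra sD dD fD.
have [pi [piD sumpi pi_id]] := directv_projections dD fD.
have pi1 : pi i 1 = 1 by rewrite (pi_id i i) ?eqxx // Di memv_line.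
pose phi := (counit \o pi i)%VF.
have phi0 j x : j != i -> x \in D j -> phi x = 0.
  by move=> ji xD; rewrite lfunE /= (pi_id i j) // eq_sym (negPf ji) linear0.
have phi1 : phi 1 = 1 by rewrite lfunE /= pi1 counit1.
have main (f : H -> H -> H) : bilin f ->
    (forall a b, phi a = 0 -> phi b = 0 -> f a b = 0) -> f 1 1 = 1 ->
    forall x : H, sweedler x f = (phi x : K) *: 1.
  move=> fb f0 f1 x; rewrite -(sumpi x) /sweedler !linear_sum scaler_suml /=.
  apply: eq_bigr => j _; have yD := piD j x; set y := pi j x in yD *.
  have [ji|ji] := eqVneq j i.
    move: yD; rewrite ji Di => /vlineP[c ->].
    by rewrite !linearZ /= comul1 tlift_bilin // f1 phi1 [c *: (1 : K^o)]mulr1.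
  rewrite (phi0 j) // scale0r; have [sub _ _] := sD j.
  have : comul y \in tensv (D j) (D j) by apply: (subvP sub); apply: memv_img.
  case/tens_mem=> w wD ->; rewrite linear_sum big1 // => a _ /=.
  rewrite tlift_bilin // f0 ?(phi0 j) //.
  by rewrite vbasis_mem // mem_nth ?size_tuple.
exists phi; split=> //; apply: main.
- exact: functional_bilinl.
- by move=> a b -> _; rewrite scale0r.
- by rewrite phi1 scale1r.
- exact: functional_bilinr.
- by move=> a b _ ->; rewrite scale0r.
- by rewrite phi1 scale1r.
Qed.

End Integral.

(** * Irreducible comatrices and orthogonality *)

Lemma lfun_exists (K : fieldType) (U V : vectType K) (f : U -> V) :
  linear f -> exists g : 'Hom(U, V), g =1 f.
Proof.
move=> lf; pose g : {linear U -> V} :=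
  HB.pack f (GRing.isLinear.Build _ _ _ _ _ lf).
by exists (linfun g) => x; rewrite lfunE.
Qed.

Section Coefficients.

Variables (K : fieldType) (H : hopfType K).

Definition cst m p (F : 'M[K]_(m, p)) : 'M[H]_(m, p) := map_mx (in_alg H) F.

(** As $f$ varies, these matrices form the representation of the convolution algebra $H^*$ attached
    to [D]; equalities of matrices over $H$ can be tested on them. *)
Definition mxf m p (f : 'Hom(H, K^o)) (D : 'M[H]_(m, p)) : 'M[K]_(m, p) :=
  \matrix_(i, j) (f (D i j) : K).

Lemma functionals_separate (x y : H) :
  (forall f : 'Hom(H, K^o), f x = f y) -> x = y.
Proof.
move=> fxy; rewrite (coord_vbasis (memvf x)) (coord_vbasis (memvf y)).
apply: eq_bigr => i _.
have [|f fE] := @lfun_exists K H K^o (coord (vbasis {:H}) i).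
  by move=> c u v; rewrite linearP.
by have := fxy f; rewrite !fE => ->.
Qed.

Lemma mxf_separate m p (A B : 'M[H]_(m, p)) :
  (forall f, mxf f A = mxf f B) -> A = B.
Proof.
move=> fAB; apply/matrixP=> i j; apply: functionals_separate => f.
by have /matrixP/(_ i j) := fAB f; rewrite !mxE.
Qed.

Lemma mul_cstl m p q (F : 'M[K]_(m, p)) (D : 'M[H]_(p, q)) i j :
  (cst F *m D) i j = \sum_k F i k *: D k j.
Proof. by rewrite mxE; apply: eq_bigr => k _; rewrite mxE mulr_algl. Qed.

Lemma mul_cstr m p q (F : 'M[K]_(p, q)) (D : 'M[H]_(m, p)) i j :
  (D *m cst F) i j = \sum_k F k j *: D i k.
Proof. by rewrite mxE; apply: eq_bigr => k _; rewrite mxE mulr_algr. Qed.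

Lemma mxf_mul_cstl m p q f (F : 'M[K]_(m, p)) (D : 'M[H]_(p, q)) :
  mxf f (cst F *m D) = F *m mxf f D.
Proof.
apply/matrixP=> i j; rewrite [LHS]mxE mul_cstl linear_sum mxE.
by apply: eq_bigr => k _ /=; rewrite linearZ mxE.
Qed.

Lemma mxf_mul_cstr m p q f (F : 'M[K]_(p, q)) (D : 'M[H]_(m, p)) :
  mxf f (D *m cst F) = mxf f D *m F.
Proof.
apply/matrixP=> i j; rewrite [LHS]mxE mul_cstr linear_sum mxE.
by apply: eq_bigr => k _ /=; rewrite linearZ mxE mulrC.
Qed.

Lemma cstM m p q (F : 'M[K]_(m, p)) (G : 'M[K]_(p, q)) : cst (F *m G) = cst F *m cst G.
Proof. exact: map_mxM. Qed.

Lemma cst1 m : cst (1%:M : 'M[K]_m) = 1%:M.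
Proof. exact: map_mx1. Qed.

Lemma mxf_counit m (D : 'M[H]_m) : comatrix D -> mxf counit D = 1%:M.
Proof. by move=> cD; apply/matrixP=> i j; rewrite !mxE cD.2. Qed.

Lemma comul_conj m r (D : 'M[H]_m) (A : 'M[K]_(r, m)) (B : 'M[K]_(m, r)) i j :
  comatrix D ->
  comul ((cst A *m D *m cst B) i j) =
    \sum_k tens ((cst A *m D) i k) ((D *m cst B) k j).
Proof.
move=> cD; rewrite mul_cstr linear_sum.
under eq_bigr => b _ do rewrite linearZ /= mul_cstl linear_sum scaler_sumr.
under [RHS]eq_bigr => k _ do rewrite mul_cstr tens_sumr.
rewrite [RHS]exchange_big; apply: eq_bigr => b _ /=.
under [RHS]eq_bigr => k _ do rewrite mul_cstl tensZr tens_suml scaler_sumr.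
rewrite [RHS]exchange_big; apply: eq_bigr => a _ /=.
rewrite linearZ /= (comul_comatrix _ _ cD) scaler_sumr scaler_sumr.
by apply: eq_bigr => k _; rewrite tensZl.
Qed.

(** The second condition on [A] and [B] says that the row space of [A] is stable under all
    [mxf f D]; the conjugate is then the comatrix of that subrepresentation. *)
Lemma comatrix_sub m r (D : 'M[H]_m) (A : 'M[K]_(r, m)) (B : 'M[K]_(m, r)) :
  comatrix D -> A *m B = 1%:M ->
  (forall f, A *m mxf f D *m B *m A = A *m mxf f D) ->
  comatrix (cst A *m D *m cst B).
Proof.
move=> cD AB1 AstD; set E := cst A *m D *m cst B.
have EA : cst A *m D = E *m cst A.
  by apply: mxf_separate => f; rewrite !mxf_mul_cstr !mxf_mul_cstl AstD.
split=> i j.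
  rewrite comul_conj // EA.
  under eq_bigr => k _ do rewrite mul_cstr tens_suml.
  rewrite exchange_big; apply: eq_bigr => l _ /=.
  have -> : E l j = (cst A *m (D *m cst B)) l j by rewrite mulmxA.
  rewrite mul_cstl tens_sumr; apply: eq_bigr => k _.
  by rewrite tensZl tensZr.
have /matrixP/(_ i j) : mxf counit E = 1%:M.
  by rewrite mxf_mul_cstr mxf_mul_cstl mxf_counit // mulmx1.
by rewrite !mxE.
Qed.

(** The square matrix [U] stands for its row space: every nonzero subspace stable under the dual
    algebra is the whole space. *)
Definition irr_comatrix m (D : 'M[H]_m) : Prop :=
  [/\ comatrix D, (0 < m)%N &
    forall U : 'M[K]_m, (forall f, stablemx U (mxf f D)) -> U <> 0 ->
      U \in unitmx].

(** Induction on the size: a proper nonzero stable row space gives a smaller comatrix, whose entries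
    are linear combinations of the old ones. *)
Lemma irr_comatrix_exists (C : {vspace H}) m (D : 'M[H]_m) :
  comatrix D -> (0 < m)%N -> (forall i j, D i j \in C) ->
  exists r (E : 'M[H]_r), irr_comatrix E /\ (forall i j, E i j \in C).
Proof.
elim/ltn_ind: m D => m IHm D cD m0 DC.
have [irr|nirr] := classic (forall U : 'M[K]_m,
  (forall f, stablemx U (mxf f D)) -> U <> 0 -> U \in unitmx).
  by exists m, D.
have [U] := not_all_ex_not _ _ nirr.
move=> nU; have [stU nU2] := imply_to_and _ _ nU.
have [/eqP U0 /negP Un] := imply_to_and _ _ nU2.
have rU : (\rank U < m)%N.
  by rewrite ltn_neqAle rank_leq_row andbT; apply: contra Un => ?; rewrite -row_full_unit.
have WV : row_base U *m pinvmx (row_base U) = 1%:M.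
  by apply: mulmxVp; apply: row_base_free.
apply: (IHm _ rU (cst (row_base U) *m D *m cst (pinvmx (row_base U)))).
- apply: comatrix_sub => // f; apply: mulmxKpV.
  by rewrite (eqmxMr _ (eq_row_base U)) eq_row_base; apply: stU.
- by rewrite lt0n mxrank_eq0.
- move=> i j; rewrite mul_cstr; apply: memv_suml => b _.
  rewrite memvZ // mul_cstl; apply: memv_suml => a _.
  by rewrite memvZ.
Qed.

(** The entries span a subcoalgebra of [C], nonzero because the counit is $1$ on a diagonal entry;
    simplicity makes it all of [C]. *)
Lemma comatrix_span m (D : 'M[H]_m) (C : {vspace H}) :
  comatrix D -> (0 < m)%N -> (forall i j, D i j \in C) ->
  simple_subcoalgebra C ->
  forall x, x \in C -> exists M : 'M[K]_m, x = \sum_i \sum_j M i j *: D i j.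
Proof.
move=> cD m0 DC [_ _ Cmin] x xC.
pose X := [seq D i j | i <- enum 'I_m, j <- enum 'I_m].
have DX i j : D i j \in X by apply: allpairs_f; rewrite mem_enum.
have XC : <<X>>%VS = C.
  case: (Cmin <<X>>%VS) => //.
  - rewrite /subcoalgebra limg_span; apply/span_subvP=> _ /mapP[_ /allpairsP[[i j] /= [_ _ ->]] ->].
    rewrite (comul_comatrix _ _ cD); apply: memv_suml => k _.
    by apply: memv_tens; apply: memv_span.
  - by apply/span_subvP=> _ /allpairsP[[i j] /= [_ _ ->]].
  - move=> X0; have := memv_span (DX (Ordinal m0) (Ordinal m0)).
    rewrite X0 memv0 => /eqP D0; have := cD.2 (Ordinal m0) (Ordinal m0).
    by rewrite D0 linear0 eqxx => /esym/eqP; rewrite oner_eq0.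
have xX : x \in <<in_tuple X>>%VS by rewrite XC.
rewrite (coord_span xX); elim/big_ind: _ => [|y z [M ->] [N ->]|k _].
- by exists 0; rewrite big1 // => i _; rewrite big1 // => j _; rewrite mxE scale0r.
- exists (M + N); rewrite -big_split; apply: eq_bigr => i _ /=.
  by rewrite -big_split; apply: eq_bigr => j _; rewrite mxE scalerDl.
- have /allpairsP[[a b] /= [_ _ ->]] : (in_tuple X)`_k \in X by rewrite mem_nth.
  set c := coord _ _ _; exists (c *: delta_mx a b).
  rewrite (bigD1 a) //= (bigD1 b) //= !mxE !eqxx mulr1 !big1 ?addr0 // => i ia.
    by rewrite big1 // => j _; rewrite !mxE (negPf ia) mulr0 scale0r.
  by rewrite !mxE (negPf ia) andbF mulr0 scale0r.
Qed.

End Coefficients.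
Arguments cst {K} H {m p} F.

Section Orthogonality.

Variables (K : closedFieldType) (H : hopfType K) (phi : 'Hom(H, K^o)).
Hypothesis phiP : integral phi.

Local Notation S := (@antipode K H).
Local Notation mxS := (map_mx S).
Local Notation mxS2 := (map_mx (fun x : H => S (S x))).

Lemma comatrix_antipodeE m (D : 'M[H]_m) i j : (mxS D)^T i j = S (D j i).
Proof. by rewrite !mxE. Qed.

Lemma integral_mull m p (v : 'I_m -> H) D (w : 'I_p -> H) E i j :
  corow v D -> corow w E ->
  \sum_a \sum_b (phi (v a * w b) : K) *: (D a i * E b j) =
    (phi (v i * w j) : K) *: 1.
Proof.
case: phiP => _ + _ vD wE => /(_ (v i * w j)) <-.
by rewrite (sweedlerM_corow i j vD wE) //; apply: functional_bilinl.
Qed.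

Lemma integral_mulr m p (v : 'I_m -> H) D (w : 'I_p -> H) E i j :
  corow v D -> corow w E ->
  \sum_a \sum_b (phi (D a i * E b j) : K) *: (v a * w b) =
    (phi (v i * w j) : K) *: 1.
Proof.
case: phiP => _ _ + vD wE => /(_ (v i * w j)) <-.
by rewrite (sweedlerM_corow i j vD wE) //; apply: functional_bilinr.
Qed.

(** Averaging with the integral: its invariance gives $D Y S(E) = Y$, and multiplying by $E$ on the
    right gives an intertwiner. *)
Lemma intertwiner_average m p (D : 'M[H]_m) (E : 'M[H]_p) j k :
  comatrix D -> comatrix E ->
  let Y := \matrix_(a, b) (phi (D a j * S (E k b)) : K) in
  D *m cst H Y = cst H Y *m E.
Proof.
move=> cD cE Y; have cE' := comatrix_antipode cE.
suff claim : D *m cst H Y *m mxS E = cst H Y.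
  by rewrite -[in RHS]claim -mulmxA mul_antipodel // mulmx1.
apply/matrixP=> i l; rewrite [RHS]mxE /= mxE.
have := integral_mulr j k (cD.1 i) (cE'.1 l).
rewrite comatrix_antipodeE => eqY.
rewrite [Y i l]mxE -eqY exchange_big; apply: eq_bigr => b _ /=.
rewrite mul_cstr mulr_suml; apply: eq_bigr => a _.
by rewrite !mxE scalerAl.
Qed.

(** The entries of $DY = YE$ lie in $A \cap B = 0$, and the counit turns $DY = 0$ into $Y = 0$. *)
Lemma orthogonal_comatrices m p (D : 'M[H]_m) (E : 'M[H]_p)
    (A B : {vspace H}) i j k l :
  comatrix D -> comatrix E -> (forall i j, D i j \in A) ->
  (forall i j, E i j \in B) -> (A :&: B = 0)%VS ->
  phi (D i j * S (E k l)) = 0.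
Proof.
move=> cD cE DA EB AB; have := intertwiner_average j k cD cE.
set Y := \matrix_(a, b) _ => /= DY.
have DY0 : D *m cst H Y = 0.
  apply/matrixP=> a b; rewrite [RHS]mxE; apply/eqP.
  rewrite -memv0 -AB memv_cap; apply/andP; split.
    by rewrite mul_cstr; apply: memv_suml => c _; rewrite memvZ.
  by rewrite DY mul_cstl; apply: memv_suml => c _; rewrite memvZ.
have : mxf counit (D *m cst H Y) = 0.
  by rewrite DY0; apply/matrixP=> a b; rewrite !mxE linear0.
rewrite mxf_mul_cstr mxf_counit // mul1mx => /matrixP/(_ i l).
by rewrite !mxE.
Qed.

(** Algebraic closedness provides an eigenvalue $y$; the left kernel of $Y - y$ is stable and
    nonzero, hence everything. *)
Lemma schur m (D : 'M[H]_m) (Y : 'M[K]_m) :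
  irr_comatrix D -> D *m cst H Y = cst H Y *m D -> exists y, Y = y%:M.
Proof.
case=> cD m0 Dirr DY.
have [y /eigenvalueP[v vY v0]] : exists y, eigenvalue Y y.
  have /closed_rootP[y ry] : size (char_poly Y) != 1%N.
    by rewrite size_char_poly eqSS -lt0n.
  by exists y; rewrite eigenvalue_root_char.
exists y; pose U := kermx (Y - y%:M).
have UY : U *m (Y - y%:M) = 0 by apply: mulmx_ker.
have fDY f : mxf f D *m Y = Y *m mxf f D.
  by rewrite -mxf_mul_cstr DY mxf_mul_cstl.
have Un : U \in unitmx.
  apply: Dirr => [f|U0].
    apply/sub_kermxP; rewrite -mulmxA mulmxBr fDY.
    by rewrite scalar_mxC -mulmxBl mulmxA UY mul0mx.
  move/eqP: v0; apply; apply/eqP; rewrite -submx0 -U0.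
  by apply/sub_kermxP; rewrite mulmxBr vY mul_mx_scalar subrr.
by apply/eqP; rewrite -subr_eq0 -(mulKmx Un (Y - _)) UY mulmx0.
Qed.

(** Schur's lemma applied to the averages of $D\,S(D)$ and $S(D)\,D$ yields two matrices $F$ and
    $G$. They have trace $1$ because $\varphi(1) = 1$, and they intertwine $D$ with $S^2(D)$ in
    opposite directions, which determines $G$ from $F$. *)
Theorem irr_orthogonality m (D : 'M[H]_m) : irr_comatrix D ->
  exists F : 'M[K]_m,
    [/\ F \in unitmx, \tr F = 1, \tr (invmx F) != 0,
        (forall i j k l, phi (D i j * S (D k l)) = (i == l)%:R * F k j) /\
        (forall i j k l, phi (S (D k l) * D i j) =
           (k == j)%:R * ((\tr (invmx F))^-1 * invmx F i l))
      & mxS2 D = cst H F *m D *m cst H (invmx F)].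
Proof.
move=> Dirr; have [cD m0 Dst] := Dirr; pose o := Ordinal m0.
pose E := (mxS D)^T; have cE : comatrix E := comatrix_antipode cD.
have EE i j : E i j = S (D j i) by rewrite !mxE.
pose F := \matrix_(k, j) (phi (D o j * S (D k o)) : K).
pose G := \matrix_(i, l) (phi (S (D o l) * D i o) : K).
have phiF i j k l : phi (D i j * S (D k l)) = (i == l)%:R * F k j.
  have [y] := schur Dirr (intertwiner_average j k cD cD).
  move=> /matrixP Yy; have := Yy i l; have := Yy o o; rewrite !mxE eqxx mulr1n => -> ->.
  by rewrite mulr_natl.
have phiG i j k l : phi (S (D k l) * D i j) = (k == j)%:R * G i l.
  pose Z := \matrix_(a, b) (phi (S (D a l) * D i b) : K).
  have ZD : mxS D *m cst H Z *m D = cst H Z.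
    apply/matrixP=> a b; rewrite [RHS]mxE /= [Z a b]mxE.
    have := integral_mull a b (cE.1 l) (cD.1 i).
    rewrite EE => <-; rewrite mxE exchange_big; apply: eq_bigr => d _ /=.
    rewrite mul_cstr mulr_suml; apply: eq_bigr => c _.
    by rewrite !EE !mxE scalerAl.
  have DZ : D *m cst H Z = cst H Z *m D.
    by rewrite -{1}ZD !mulmxA mul_antipoder // mul1mx.
  have [y /matrixP Yy] := schur Dirr DZ.
  have := Yy k j; have := Yy o o; rewrite !mxE eqxx mulr1n => -> ->.
  by rewrite mulr_natl.
have phi1 : phi 1 = 1 by case: phiP.
have trF : \tr F = 1.
  rewrite -phi1; have := congr1 phi (sum_antipoder o o cD); rewrite eqxx => <-.
  rewrite linear_sum; apply: eq_bigr => j _ /=.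
  by rewrite phiF eqxx mul1r.
have trG : \tr G = 1.
  rewrite -phi1; have := congr1 phi (sum_antipodel o o cD); rewrite eqxx => <-.
  rewrite linear_sum; apply: eq_bigr => j _ /=.
  by rewrite phiG eqxx mul1r.
have one_neq0 : (1 : K) != 0 by apply: oner_neq0.
(* Invariance in the form [key] reads $\sum_b (FD)_{bj} S(D_{kb}) = F_{kj}$; multiplying on the
   right by $S^2(D_{ck})$ and summing over $k$ removes the factor $S(D_{kb})$. *)
have FD : cst H F *m D = mxS2 D *m cst H F.
  apply/matrixP=> c j; rewrite mul_cstr.
  have key k : \sum_b (cst H F *m D) b j * E b k = F k j *: 1.
    have := integral_mull j k (cD.1 o) (cE.1 o).
    rewrite EE phiF eqxx mul1r => <-.
    rewrite exchange_big; apply: eq_bigr => b _ /=.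
    rewrite mul_cstl mulr_suml; apply: eq_bigr => a _.
    by rewrite !EE phiF eqxx mul1r scalerAl.
  transitivity (\sum_k (\sum_b (cst H F *m D) b j * E b k) * S (E k c)).
    under [RHS]eq_bigr => k _ do rewrite mulr_suml.
    rewrite exchange_big -[LHS](sum_mulr_delta (fun b => (cst H F *m D) b j)).
    apply: eq_bigr => b _ /=; rewrite -(sum_antipoder b c cE) mulr_sumr.
    by apply: eq_bigr => k _; rewrite mulrA.
  by apply: eq_bigr => k _; rewrite key -scalerAl mul1r EE [mxS2 D c k]mxE.
have DG : D *m cst H G = cst H G *m mxS2 D.
  apply/matrixP=> i c; rewrite mul_cstl.
  have key l : \sum_a E l a * (D *m cst H G) i a = G i l *: 1.
    have := integral_mulr o o (cE.1 l) (cD.1 i).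
    rewrite EE phiG eqxx mul1r => <-.
    apply: eq_bigr => a _ /=.
    rewrite mul_cstr mulr_sumr; apply: eq_bigr => b _.
    by rewrite !EE phiG eqxx mul1r -scalerAr.
  transitivity (\sum_l S (E c l) * (\sum_a E l a * (D *m cst H G) i a)).
    under [RHS]eq_bigr => k _ do rewrite mulr_sumr.
    rewrite exchange_big -[LHS](sum_mull_delta (fun b => (D *m cst H G) i b)).
    apply: eq_bigr => b _ /=; rewrite eq_sym -(sum_antipodel c b cE) mulr_suml.
    by apply: eq_bigr => k _; rewrite mulrA.
  by apply: eq_bigr => k _; rewrite key -scalerAr mulr1 EE [mxS2 D k c]mxE.
have Fu : F \in unitmx.
  apply: Dst => [f|F0]; last first.
    by move/eqP: trF; rewrite F0 mxtrace0 eq_sym (negPf one_neq0).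
  by rewrite -mxf_mul_cstl FD mxf_mul_cstr submxMl.
have Gu : G \in unitmx.
  rewrite -row_free_unit -kermx_eq0; apply/eqP.
  apply: NNPP => kG.
  have : kermx G \in unitmx.
    apply: Dst => // f; apply/sub_kermxP.
    by rewrite -mulmxA -mxf_mul_cstr DG mxf_mul_cstl mulmxA mulmx_ker mul0mx.
  move=> kGu; have G0 : G = 0 by rewrite -(mulKmx kGu G) mulmx_ker mulmx0.
  by move/eqP: trG; rewrite G0 mxtrace0 eq_sym (negPf one_neq0).
have S2D : mxS2 D = cst H F *m D *m cst H (invmx F).
  by rewrite FD -mulmxA -cstM mulmxV // cst1 mulmx1.
(* $F$ carries $D$ to $S^2(D)$ and $G$ carries it back, so $GF$ commutes with $D$ and is a scalar;
   $\mathrm{tr}\, G = 1$ then makes it $1/\mathrm{tr}(F^{-1})$. *)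
have [s GFs] : exists s, G *m F = s%:M.
  by apply: (schur Dirr); rewrite !cstM mulmxA DG -!mulmxA FD.
have Gs : G = s *: invmx F.
  by rewrite -(mulmxK Fu G) GFs mul_scalar_mx.
have sF : s * \tr (invmx F) = 1 by rewrite -mxtraceZ -Gs.
have tF0 : \tr (invmx F) != 0.
  by apply: contra one_neq0 => /eqP t0; rewrite -sF t0 mulr0.
exists F; split=> //; split=> // i j k l.
rewrite phiG Gs mxE; congr (_ * (_ * _)).
by apply: (mulIf tF0); rewrite sF mulVf.
Qed.

End Orthogonality.

(** * Bases of matrix coefficients adapted to the integral *)

Section Blocks.

Variables (K : closedFieldType) (H : hopfType K) (phi : 'Hom(H, K^o)).
Local Notation S := (@antipode K H).

(** A Peter-Weyl decomposition of $H$: one comatrix for each simple subcoalgebra, with the matrix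
    [F a] of trace $1$ that implements $S^2$ on it and governs the orthogonality relations of
    [phi]. *)
Record block_system r (m : 'I_r -> nat) (D : forall a, 'M[H]_(m a))
    (F : forall a, 'M[K]_(m a)) : Prop := BlockSystem {
  block_comatrix : forall a, comatrix (D a);
  block_unit : forall a, F a \in unitmx;
  block_tr : forall a, \tr (F a) = 1;
  block_trV : forall a, \tr (invmx (F a)) != 0;
  block_orthl : forall a i j k l,
    phi (D a i j * S (D a k l)) = (i == l)%:R * F a k j;
  block_orthr : forall a i j k l,
    phi (S (D a k l) * D a i j) =
      (k == j)%:R * ((\tr (invmx (F a)))^-1 * invmx (F a) i l);
  block_orth0l : forall a b i j k l, a != b -> phi (D a i j * S (D b k l)) = 0;
  block_orth0r : forall a b i j k l, a != b -> phi (S (D a k l) * D b i j) = 0;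
  block_S2 : forall a i j,
    S (S (D a i j)) = (cst H (F a) *m D a *m cst H (invmx (F a))) i j;
  block_span : forall x, exists M : forall a, 'M[K]_(m a),
    x = \sum_a \sum_i \sum_j M a i j *: D a i j }.

End Blocks.

Section BlockExists.

Variables (K : closedFieldType) (H : hopfType K) (phi : 'Hom(H, K^o)).
Hypothesis phiP : integral phi.
Local Notation S := (@antipode K H).

(** The mirror image of [orthogonal_comatrices], obtained from the invariance of the integral on the
    other side. *)
Lemma orthogonal_comatricesr m p (D : 'M[H]_m) (E : 'M[H]_p)
    (A B : {vspace H}) i j k l :
  comatrix D -> comatrix E -> (forall i j, D i j \in A) ->
  (forall i j, E i j \in B) -> (A :&: B = 0)%VS ->
  phi (S (D k l) * E i j) = 0.
Proof.
move=> cD cE DA EB AB; pose Z := \matrix_(a, b) (phi (S (D a l) * E i b) : K).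
have cT := comatrix_antipode cD.
have ZD : map_mx S D *m cst H Z *m E = cst H Z.
  apply/matrixP=> a b; rewrite [RHS]mxE /= [Z a b]mxE.
  have := integral_mull phiP a b (cT.1 l) (cE.1 i).
  rewrite comatrix_antipodeE => <-; rewrite mxE exchange_big.
  apply: eq_bigr => d _ /=.
  rewrite mul_cstr mulr_suml; apply: eq_bigr => c _.
  by rewrite !mxE scalerAl.
have DZ : D *m cst H Z = cst H Z *m E.
  by rewrite -{1}ZD !mulmxA mul_antipoder // mul1mx.
have DZ0 : D *m cst H Z = 0.
  apply/matrixP=> a b; rewrite [RHS]mxE; apply/eqP.
  rewrite -memv0 -AB memv_cap; apply/andP; split.
    by rewrite mul_cstr; apply: memv_suml => c _; rewrite memvZ.
  by rewrite DZ mul_cstl; apply: memv_suml => c _; rewrite memvZ.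
have : mxf counit (D *m cst H Z) = 0.
  by rewrite DZ0; apply/matrixP=> a b; rewrite !mxE linear0.
rewrite mxf_mul_cstr mxf_counit // mul1mx => /matrixP/(_ k j).
by rewrite !mxE.
Qed.

Lemma block_system_exists : cosemisimple H ->
  exists r (m : 'I_r -> nat) (D : forall a, 'M[H]_(m a)) (F : forall a, 'M[K]_(m a)),
    block_system phi D F.
Proof.
case=> r [C [sC dC fC]].
have ex1 a : exists q : {m : nat & 'M[H]_m},
    irr_comatrix (projT2 q) /\ (forall i j, projT2 q i j \in C a).
  have [sub C0 _] := sC a.
  have [D [_ cD DC]] := coideal_comatrix sub.
  have dC0 : (0 < \dim (C a))%N by rewrite lt0n dimv_eq0; apply/eqP.
  have [m [E [irrE EC]]] := irr_comatrix_exists cD dC0 DC.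
  by exists (existT (fun m => 'M[H]_m) m E).
have [q qP] := fin_all_exists ex1.
pose m a := projT1 (q a); pose D a : 'M[H]_(m a) := projT2 (q a).
have Dirr a : irr_comatrix (D a) by case: (qP a).
have DC a i j : D a i j \in C a by case: (qP a) => _; apply.
have cD a : comatrix (D a) by case: (Dirr a).
have C0 a b : a != b -> (C a :&: C b = 0)%VS.
  move=> ab; apply/eqP; rewrite -subv0; apply/subvP=> x; rewrite memv_cap => /andP[xa xb].
  have /directv_sumP/(_ a isT) <- := dC; rewrite memv_cap xa /=.
  by rewrite (bigD1 b) 1?eq_sym //=; apply: subvP xb; apply: addvSl.
have [F FP] := fin_all_exists (fun a => irr_orthogonality phiP (Dirr a)).
exists r, m, D, F; split=> //.
- by move=> a; case: (FP a).
- by move=> a; case: (FP a).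
- by move=> a; case: (FP a).
- by move=> a i j k l; case: (FP a) => _ _ _ [] ->.
- by move=> a i j k l; case: (FP a) => _ _ _ [_ ->].
- by move=> a b i j k l /C0; apply: orthogonal_comatrices.
- by move=> a b i j k l /C0; apply: orthogonal_comatricesr.
- by move=> a i j; case: (FP a) => _ _ _ _ <-; rewrite mxE.
move=> x; have [pi [piC sumpi _]] := directv_projections dC fC.
have ex2 a : exists M : 'M[K]_(m a), pi a x = \sum_i \sum_j M i j *: D a i j.
  by case: (Dirr a) => _ m0 _; apply: (comatrix_span (cD a) m0 (DC a) (sC a)).
have [M MP] := fin_all_exists ex2.
by exists M; rewrite -{1}(sumpi x); apply: eq_bigr => a _.
Qed.

End BlockExists.

Section BlockTheory.

Variables (K : closedFieldType) (H : hopfType K) (phi : 'Hom(H, K^o)).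
Variables (r : nat) (m : 'I_r -> nat) (D : forall a, 'M[H]_(m a)).
Variable F : forall a, 'M[K]_(m a).
Arguments D : clear implicits.
Arguments F : clear implicits.
Hypothesis phiP : integral phi.
Hypothesis bs : block_system phi D F.
Local Notation S := (@antipode K H).
Local Notation t a := (\tr (invmx (F a))).

Lemma block_ind (P : H -> Prop) :
  (forall c x y, P x -> P y -> P (c *: x + y)) ->
  (forall a i j, P (D a i j)) -> forall x, P x.
Proof.
move=> Plin PD.
(* Zero has to be reached from some entry [D a i i]: without blocks $1$ would be an empty sum, and
   an empty block would contradict $\mathrm{tr}\, F_a = 1$. *)
have P0 : P 0.
  have [a _|r0] := pickP (fun a : 'I_r => true); last first.
    have [M] := block_span bs 1; rewrite big1 => [/eqP|a _].
      by rewrite oner_eq0.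
    by have := r0 a.
  have [i _|m0] := pickP (fun i : 'I_(m a) => true).
    by have := Plin (-1) _ _ (PD a i i) (PD a i i); rewrite scaleN1r addNr.
  have := block_tr bs a; rewrite /mxtrace big1 => [/eqP|i _].
    by rewrite eq_sym oner_eq0.
  by have := m0 i.
have Psum I (s : seq I) (G : I -> H) : (forall i, P (G i)) -> P (\sum_(i <- s) G i).
  by move=> PG; elim/big_ind: _ => // a b Pa Pb; rewrite -[a]scale1r; apply: Plin.
have PZ c y : P y -> P (c *: y) by move=> Py; rewrite -[c *: y]addr0; apply: Plin.
move=> x; have [M ->] := block_span bs x.
by apply: (Psum) => a; apply: (Psum) => i; apply: (Psum) => j; apply: PZ; apply: PD.
Qed.

(** The coordinate of [x] at the entry [D a i j]: the factor $F_a^{-1}$ turns the orthogonality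
    relations into a duality. *)
Definition block_coord a i j (x : H) : K :=
  \sum_k invmx (F a) j k * phi (x * S (D a k i)).

Arguments block_coord : clear implicits.

Lemma block_coord_linear a i j : linear (block_coord a i j : H -> K^o).
Proof.
move=> c x y; rewrite /block_coord scaler_sumr -big_split; apply: eq_bigr => k _ /=.
by rewrite mulrDl -scalerAl linearP mulrDr /= mulrCA.
Qed.


HB.instance Definition _ a i j := GRing.isLinear.Build K H K^o _
  (block_coord a i j : H -> K^o) (@block_coord_linear a i j).

Lemma block_coord_same a i j k l :
  block_coord a i j (D a k l) = (k == i)%:R * (l == j)%:R.
Proof.
rewrite /block_coord.
under eq_bigr => b _ do rewrite (block_orthl bs) mulrCA.
rewrite -mulr_sumr; congr (_ * _).
have /matrixP/(_ j l) := mulVmx (block_unit bs a).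
by rewrite !mxE eq_sym => ->.
Qed.

Lemma block_coord_diff a b i j k l : b != a -> block_coord a i j (D b k l) = 0.
Proof.
move=> ab; rewrite /block_coord big1 // => c _.
by rewrite (block_orth0l bs) ?mulr0.
Qed.

Lemma block_coordE x : x = \sum_a \sum_i \sum_j block_coord a i j x *: D a i j.
Proof.
move: x; apply: block_ind => [c x y Px Py|b k l].
  rewrite {1}Px {1}Py !scaler_sumr -big_split; apply: eq_bigr => a _ /=.
  rewrite !scaler_sumr -big_split; apply: eq_bigr => i _ /=.
  rewrite !scaler_sumr -big_split; apply: eq_bigr => j _ /=.
  by rewrite block_coord_linear scalerDl scalerA.
rewrite (bigD1 b) //= [X in _ + X]big1 ?addr0 => [|a ab]; last first.
  rewrite big1 // => i _; rewrite big1 // => j _.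
  by rewrite block_coord_diff 1?eq_sym // scale0r.
rewrite (bigD1 k) //= [X in _ + X]big1 ?addr0 => [|i ik]; last first.
  by rewrite big1 // => j _; rewrite block_coord_same eq_sym (negPf ik) mul0r scale0r.
rewrite (bigD1 l) //= [X in _ + X]big1 ?addr0 => [|j jl]; last first.
  by rewrite block_coord_same [l == j]eq_sym (negPf jl) mulr0 scale0r.
by rewrite block_coord_same !eqxx mulr1 scale1r.
Qed.

Lemma block_orthr_conj a (A B : 'M[K]_(m a)) i j k l :
  phi (S (D a k l) * (cst H A *m D a *m cst H B) i j) =
  B k j * ((t a)^-1 * (A *m invmx (F a)) i l).
Proof.
rewrite mul_cstr mulr_sumr linear_sum (bigD1 k) //= [X in _ + X]big1; last first.
  move=> q qk; rewrite mul_cstl scaler_sumr mulr_sumr linear_sum big1 // => p _.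
  rewrite -!scalerAr !linearZ /= (block_orthr bs) eq_sym (negPf qk).
  by rewrite mul0r !scaler0.
rewrite addr0 -scalerAr linearZ; congr (_ * _).
rewrite mul_cstl mulr_sumr linear_sum mxE mulr_sumr; apply: eq_bigr => p _ /=.
by rewrite -scalerAr linearZ /= (block_orthr bs) eqxx mul1r [LHS]mulrCA.
Qed.

(** For the coordinate matrix $M$ of $x$ in block $a$, testing against $y = S(D_{jl})$ gives the
    entry $(j, l)$ of $M^T F_a^{-1}$ up to the nonzero factor $1/t_a$. *)
Lemma integral_nondegr x : (forall y, phi (y * x) = 0) -> x = 0.
Proof.
move=> x0; rewrite [x]block_coordE big1 // => a _.
pose M := \matrix_(i, j) block_coord a i j x.
suff M0 : M = 0.
  rewrite big1 // => i _; rewrite big1 // => j _.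
  by move/matrixP/(_ i j): M0; rewrite !mxE => ->; rewrite scale0r.
suff : M^T *m invmx (F a) = 0.
  have Fu := block_unit bs a.
  move/(congr1 (mulmx^~ (F a))); rewrite mulmxKV // mul0mx => /(congr1 trmx).
  by rewrite trmxK trmx0.
apply/matrixP=> j l; rewrite mxE [RHS]mxE.
have := x0 (S (D a j l)); rewrite {1}[x]block_coordE mulr_sumr linear_sum /=.
rewrite (bigD1 a) //= [X in _ + X]big1 ?addr0 => [|b ba]; last first.
  rewrite mulr_sumr linear_sum big1 // => i _; rewrite mulr_sumr linear_sum big1 // => k _ /=.
  by rewrite -scalerAr linearZ /= (block_orth0r bs) ?scaler0 // eq_sym.
rewrite mulr_sumr linear_sum /= => eq0.
apply: (mulfI (invr_neq0 (block_trV bs a))); rewrite mulr0 -[RHS]eq0 mulr_sumr.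
apply: eq_bigr => i _; rewrite mulr_sumr linear_sum /= (bigD1 j) //=.
rewrite [X in _ + X]big1 ?addr0 => [|k kj].
  by rewrite -scalerAr linearZ /= (block_orthr bs) eqxx mul1r !mxE mulrCA.
by rewrite -scalerAr linearZ /= (block_orthr bs) eq_sym (negPf kj) mul0r scaler0.
Qed.

(** If $S(z) = 0$, then $0 = \varphi(D_{ij} S(z))$ is the entry $(i, j)$ of $M^T F_a$, with $M$ the
    coordinate matrix of $z$ in the block. *)
Lemma antipode_inj : injective S.
Proof.
move=> x y /eqP; rewrite -subr_eq0 -linearB => /eqP Sz; apply/eqP.
rewrite -subr_eq0; apply/eqP; move: Sz; move: (x - y) => {x y} z Sz.
rewrite [z]block_coordE big1 // => a _.
pose M := \matrix_(i, j) block_coord a i j z.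
suff M0 : M = 0.
  rewrite big1 // => i _; rewrite big1 // => j _.
  by move/matrixP/(_ i j): M0; rewrite !mxE => ->; rewrite scale0r.
suff : M^T *m F a = 0.
  have Fu := block_unit bs a.
  move/(congr1 (mulmx^~ (invmx (F a)))); rewrite mulmxK // mul0mx => /(congr1 trmx).
  by rewrite trmxK trmx0.
apply/matrixP=> i j; rewrite mxE [RHS]mxE.
have : phi (D a i j * S z) = 0 by rewrite Sz mulr0 linear0.
rewrite {1}[z]block_coordE linear_sum mulr_sumr linear_sum /=.
rewrite (bigD1 a) //= [X in _ + X]big1 ?addr0 => [|b ba]; last first.
  rewrite linear_sum mulr_sumr linear_sum big1 // => k _.
  rewrite linear_sum mulr_sumr linear_sum big1 // => l _ /=.
  by rewrite linearZ -scalerAr linearZ /= (block_orth0l bs) ?scaler0 // eq_sym.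
rewrite linear_sum mulr_sumr linear_sum /= => eq0; rewrite -[RHS]eq0.
apply: eq_bigr => k _; rewrite linear_sum mulr_sumr linear_sum /= (bigD1 i) //=.
rewrite [X in _ + X]big1 ?addr0 => [|l li].
  by rewrite linearZ -scalerAr linearZ /= (block_orthl bs) eqxx mul1r !mxE.
by rewrite linearZ -scalerAr linearZ /= (block_orthl bs) eq_sym (negPf li) mul0r scaler0.
Qed.

Lemma antipode_surj x : exists y, x = S y.
Proof.
have k0 : lker S == 0%VS by apply/lker0P; apply: antipode_inj.
by exists (S^-1%VF x); rewrite lker0_lfunVK.
Qed.

End BlockTheory.
Arguments block_coord {K H} phi {r m} D F a i j x.

(** * Characters and the Nakayama automorphism *)

Section Convolution.

Variables (K : fieldType) (H : hopfType K).
Implicit Types f g : 'Hom(H, K^o).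

Definition conv_map f g (x : H) : K^o :=
  sweedler x (fun x1 x2 => (f x1 : K^o) * (g x2 : K^o)).

Lemma conv_map_is_linear f g : linear (conv_map f g).
Proof. by move=> c x y; rewrite /conv_map /sweedler !linearP. Qed.

HB.instance Definition _ f g :=
  GRing.isLinear.Build K H K^o _ (conv_map f g) (conv_map_is_linear f g).

Definition conv f g : 'Hom(H, K^o) := linfun (conv_map f g).

Lemma conv_bilin f g : bilin (fun x1 x2 : H => (f x1 : K^o) * (g x2 : K^o)).
Proof.
split=> [w|u] c x y /=; first by rewrite linearP mulrDl -scalerAl.
by rewrite linearP mulrDr -scalerAr.
Qed.

Lemma mxf_conv f g m (D : 'M[H]_m) :
  comatrix D -> mxf (conv f g) D = mxf f D *m mxf g D.
Proof.
move=> cD; apply/matrixP=> i j; rewrite mxE lfunE /= /conv_map.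
rewrite (sweedler_comatrix i j cD (conv_bilin f g)) mxE.
by apply: eq_bigr => k _; rewrite !mxE.
Qed.

(** These characters are the group-like elements of the dual Hopf algebra; convolution is their
    product. *)
Definition multiplicative f : Prop :=
  f 1 = 1 /\ forall x y : H, f (x * y) = (f x : K^o) * f y.

Lemma counit_multiplicative : multiplicative counit.
Proof. by split; [apply: counit1 | apply: counitM]. Qed.

Lemma conv_multiplicative f g :
  multiplicative f -> multiplicative g -> multiplicative (conv f g).
Proof.
move=> [f1 fM] [g1 gM]; split.
  rewrite lfunE /= /conv_map /sweedler comul1 tlift_bilin ?f1 ?g1 ?mulr1 //.
  exact: conv_bilin.
move=> x y; move: x; apply: comatrix_ind => [c a b Pa Pb|m D cD i j].
  by rewrite mulrDl -scalerAl !linearP /= Pa Pb mulrDl -scalerAl.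
move: y; apply: comatrix_ind => [c a b Pa Pb|p E cE k l].
  by rewrite mulrDr -scalerAr !linearP /= Pa Pb mulrDr -scalerAr.
rewrite [LHS]lfunE /= /conv_map.
rewrite (sweedlerM_corow j l (cD.1 i) (cE.1 k) (conv_bilin f g)).
have /matrixP/(_ i j) := mxf_conv f g cD; rewrite !mxE => ->.
have /matrixP/(_ k l) := mxf_conv f g cE; rewrite !mxE => ->.
rewrite mulr_suml; apply: eq_bigr => a _; rewrite mulr_sumr.
by apply: eq_bigr => b _; rewrite !mxE fM gM mulrACA.
Qed.

(** Dedekind's argument: subtracting $A_{\max}(x) \sum_i c_i A_i(y)$ from $\sum_i c_i A_i(xy)$
    eliminates the last character. *)
Lemma multiplicative_independent n (A : 'I_n -> 'Hom(H, K^o)) (c : 'I_n -> K) :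
  (forall i, multiplicative (A i)) -> injective A ->
  (forall x, \sum_i c i * (A i x : K) = 0) -> forall i, c i = 0.
Proof.
elim: n A c => [|n IHn] A c AM Ainj cA0 i; first by case: i.
have c0 (j : 'I_n) : c (widen_ord (leqnSn n) j) = 0.
  apply/eqP; apply: contraT => cj.
  pose w := widen_ord (leqnSn n).
  have Aeq x : A (w j) x = A ord_max x.
    apply/eqP; rewrite -subr_eq0; apply/eqP; apply: (mulfI cj); rewrite mulr0.
    have winj : injective (fun k => A (w k)).
      by move=> k l /Ainj /(congr1 val) /= /val_inj.
    apply: (IHn _ (fun k => c (w k) * ((A (w k) x : K) - (A ord_max x : K)))
      (fun k => AM (w k)) winj) => y.
    transitivity (\sum_i c i * (A i (x * y) : K)
      - (A ord_max x : K) * \sum_i c i * (A i y : K)); last first.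
      by rewrite !cA0 mulr0 subr0.
    rewrite mulr_sumr -sumrB big_ord_recr /= (AM ord_max).2.
    rewrite [X in _ = _ + X](_ : _ = 0) ?addr0; last by rewrite mulrCA subrr.
    apply: eq_bigr => k _; rewrite (AM _).2 mulrBr mulrBl; congr (_ - _).
      by rewrite -mulrA.
    by rewrite -mulrA mulrCA.
  have /lfunP/Ainj/(congr1 val)/= jn : A (w j) =1 A ord_max by [].
  by have := ltn_ord j; rewrite jn ltnn.
case: (unliftP ord_max i) => [j ->|->].
  by rewrite -(c0 j); congr c; apply: val_inj; rewrite /= /bump leqNgt ltn_ord.
have := cA0 1; rewrite big_ord_recr /= (AM ord_max).1 mulr1 big1 ?add0r // => j _.
by rewrite c0 mul0r.
Qed.

(** Characters that are pairwise distinct are independent, so more of them than the dimension of the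
    dual cannot exist. *)
Lemma multiplicative_collision (A : nat -> 'Hom(H, K^o)) :
  (forall k, multiplicative (A k)) -> exists i j, (i < j)%N /\ A i = A j.
Proof.
move=> AM; pose N := (\dim {: 'Hom(H, K^o)}).+1.
have [/existsP[i /existsP[j /andP[ij /eqP Aij]]]|nex] :=
    boolP [exists i : 'I_N, [exists j : 'I_N, (i < j)%N && (A i == A j)]].
  by exists i, j.
have Ainj : injective (fun i : 'I_N => A i).
  move=> i j Aij; apply: val_inj.
  have h (k l : 'I_N) : A k = A l -> ~~ (k < l)%N.
    move=> Akl; apply: contra nex => kl.
    by apply/existsP; exists k; apply/existsP; exists l; rewrite kl Akl /=.
  by case: (ltngtP i j) => //= lt; [have := h _ _ Aij | have := h _ _ (esym Aij)]; rewrite lt.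
pose X := [tuple A i | i < N].
have fX : free X.
  apply/freeP=> c cX i; apply: (multiplicative_independent (fun i : 'I_N => AM i) Ainj) => x.
  transitivity ((\sum_(i < N) c i *: X`_i) x); last by rewrite cX lfunE.
  rewrite sum_lfunE; apply: eq_bigr => j _.
  by rewrite -tnth_nth tnth_mktuple scale_lfunE.
have := dimvS (subvf <<X>>); move: fX; rewrite /free size_tuple => /eqP ->.
by rewrite ltnn.
Qed.

End Convolution.

Section Nakayama.

Variables (K : closedFieldType) (H : hopfType K) (phi : 'Hom(H, K^o)).
Variables (r : nat) (m : 'I_r -> nat) (D : forall a, 'M[H]_(m a)).
Variable F : forall a, 'M[K]_(m a).
Arguments D : clear implicits.
Arguments F : clear implicits.
Hypothesis phiP : integral phi.
Hypothesis bs : block_system phi D F.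
Local Notation S := (@antipode K H).
Local Notation t a := (\tr (invmx (F a))).

Lemma block_extend (V : vectType K) (G : forall a, 'M[V]_(m a)) :
  exists g : 'Hom(H, V), forall a i j, g (D a i j) = G a i j.
Proof.
have [|g gE] := @lfun_exists K H V
    (fun x => \sum_a \sum_i \sum_j block_coord phi D F a i j x *: G a i j).
  move=> c x y; rewrite scaler_sumr -big_split; apply: eq_bigr => a _ /=.
  rewrite scaler_sumr -big_split; apply: eq_bigr => i _ /=.
  rewrite scaler_sumr -big_split; apply: eq_bigr => j _ /=.
  by rewrite block_coord_linear scalerDl scalerA.
exists g => b k l; rewrite gE.
rewrite (bigD1 b) //= [X in _ + X]big1 ?addr0 => [|a ab]; last first.
  rewrite big1 // => i _; rewrite big1 // => j _.
  by rewrite (block_coord_diff bs) 1?eq_sym // scale0r.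
rewrite (bigD1 k) //= [X in _ + X]big1 ?addr0 => [|i ik]; last first.
  by rewrite big1 // => j _; rewrite (block_coord_same bs) eq_sym (negPf ik) mul0r scale0r.
rewrite (bigD1 l) //= [X in _ + X]big1 ?addr0 => [|j jl]; last first.
  by rewrite (block_coord_same bs) [l == j]eq_sym (negPf jl) mulr0 scale0r.
by rewrite (block_coord_same bs) !eqxx mulr1 scale1r.
Qed.

(** With $N(D) = t\, F D F$ on each block, both sides of $\varphi(xy) = \varphi(y N(x))$ are given
    by the orthogonality relations when $x$ is an entry and $y$ the antipode of one.
    Multiplicativity of $N$ follows from this identity and nondegeneracy. *)
Lemma nakayama_exists : exists N : 'End(H),
  [/\ forall x y, phi (x * y) = phi (y * N x),
      forall x y, N (x * y) = N x * N y, N 1 = 1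
    & forall a i j, N (D a i j) = t a *: (cst H (F a) *m D a *m cst H (F a)) i j].
Proof.
have [N ND] := block_extend (fun a =>
  map_mx (fun x => t a *: x) (cst H (F a) *m D a *m cst H (F a))).
have {}ND a i j : N (D a i j) = t a *: (cst H (F a) *m D a *m cst H (F a)) i j.
  by rewrite ND mxE.
have phiN x y : phi (x * y) = phi (y * N x).
  have [z ->] := antipode_surj bs y; move: x z.
  apply: (block_ind bs) => [c x y' Px Py z|b i j z].
    by rewrite mulrDl -scalerAl !linearP /= Px Py mulrDr -scalerAr linearP.
  move: z; apply: (block_ind bs) => [c x y' Px Py|a k l].
    by rewrite linearP mulrDr -scalerAr linearP /= Px Py mulrDl -scalerAl linearP.
  rewrite ND -scalerAr linearZ /=; have [ab|ba] := eqVneq a b.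
    move: ab k l => -> k l {a}; rewrite (block_orthr_conj bs) (block_orthl bs).
    rewrite mulmxV ?(block_unit bs) // mxE.
    rewrite -[RHS]/(t b * (F b k j * ((t b)^-1 * (i == l)%:R))).
    by rewrite mulrCA mulVKf ?(block_trV bs) // mulrC.
  rewrite (block_orth0l bs) 1?eq_sym // mul_cstr mulr_sumr linear_sum big1 ?scaler0 //.
  move=> q _; rewrite mul_cstl scaler_sumr mulr_sumr linear_sum big1 // => p _.
  by rewrite -!scalerAr !linearZ /= (block_orth0r bs) // !scaler0.
exists N; split=> // [x y|].
  apply/eqP; rewrite -subr_eq0; apply/eqP; apply: (integral_nondegr bs) => z.
  rewrite mulrBr linearB /= -phiN mulrA -!phiN -mulrA.
  by rewrite phiN !mulrA -phiN subrr.
apply/eqP; rewrite -subr_eq0; apply/eqP; apply: (integral_nondegr bs) => z.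
by rewrite mulrBr linearB /= -phiN mul1r mulr1 subrr.
Qed.

(** The character $\alpha = \varepsilon \circ N$ takes the value $t_a F_a^2$ on block $a$. Two of
    its convolution powers coincide, and cancelling gives one exponent valid for all blocks at
    once. *)
Lemma block_finite_order : exists2 M : nat, (0 < M)%N &
  forall a, (t a *: (F a *m F a)) ^+ M = 1%:M.
Proof.
have [N [phiN NM N1 ND]] := nakayama_exists.
pose al : 'Hom(H, K^o) := (counit \o N)%VF.
have alM : multiplicative al.
  split; first by rewrite lfunE /= N1 counit1.
  by move=> x y; rewrite !lfunE /= NM counitM.
have alD a : mxf al (D a) = t a *: (F a *m F a).
  apply/matrixP=> i j; rewrite mxE lfunE /= ND linearZ /= [RHS]mxE.
  have : mxf counit (cst H (F a) *m D a *m cst H (F a)) = F a *m F a.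
    by rewrite mxf_mul_cstr mxf_mul_cstl mxf_counit ?mulmx1 //; apply: block_comatrix bs a.
  by move/matrixP/(_ i j); rewrite mxE => ->.
pose A k := iter k (fun f => conv f al) counit.
have AM k : multiplicative (A k).
  elim: k => [|k IHk]; first exact: counit_multiplicative.
  exact: conv_multiplicative.
have AD k a : mxf (A k) (D a) = (t a *: (F a *m F a)) ^+ k.
  have cD := block_comatrix bs a.
  elim: k => [|k IHk]; first by rewrite expr0 mxf_counit.
  by rewrite /A iterS mxf_conv // -/(A k) IHk alD exprSr.
have [i [j [ij Aij]]] := multiplicative_collision AM.
exists (j - i)%N => [|a]; first by rewrite subn_gt0.
set B := t a *: _.
have Bu k : B ^+ k \in unitmx.
  have B1 : B \in unitmx.
    by rewrite unitmxZ ?unitfE ?(block_trV bs) // unitmx_mul !(block_unit bs).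
  by elim: k => [|k IHk]; rewrite ?expr0 ?unitmx1 // exprS unitmx_mul B1.
have : B ^+ (i + (j - i)) = B ^+ i by rewrite subnKC ?(ltnW ij) // -!AD Aij.
rewrite exprD => /(congr1 (mulmx (invmx (B ^+ i)))).
by rewrite mulKmx // mulVmx.
Qed.

End Nakayama.

(** * Sums of roots of unity *)

Section CyclotomicTransfer.

Import Num.Theory.

Local Notation pQtoC := (map_poly (ratr : rat -> algC)).

Lemma intr_neq0 (K : fieldType) (a : int) :
  [pchar K] =i pred0 -> a != 0 -> (a%:~R : K) != 0.
Proof.
move=> /pcharf0P ch; case: a => n; first by rewrite -pmulrn ch.
by move=> _; rewrite NegzE mulrNz oppr_eq0 -pmulrn ch.
Qed.

(** $\Phi_N$ is the minimal polynomial of $z$ over the rationals, so a nonzero $p$ of smaller degree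
    is coprime to it. Clearing denominators in a Bezout relation gives an integral relation,
    meaningful in every field. *)
Lemma Cyclotomic_coprime N (z : algC) (p : {poly int}) :
  N.-primitive_root z -> p != 0 -> (size p < size 'Phi_N)%N ->
  exists u v (a : int), a != 0 /\ u * p + v * 'Phi_N = a%:P.
Proof.
move=> zN p0 sp; pose toQ := map_poly (intr : int -> rat).
have [q [qz qmon] qroot] := minCpolyP z.
have qPhi : q = toQ 'Phi_N.
  apply: (map_poly_inj (ratr : {rmorphism rat -> algC})) => /=.
  rewrite -qz (minCpoly_cyclotomic zN) -(Cintr_Cyclotomic zN) -map_poly_comp.
  by apply: eq_map_poly => c /=; rewrite ratr_int.
have rz : root (pQtoC q) z by rewrite qroot.
have toQ0 : toQ p != 0.
  by rewrite map_poly_eq0_id0 ?lead_coef_eq0 // intr_eq0 lead_coef_eq0.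
have sQ (f : {poly int}) : size (toQ f) = size f.
  by rewrite size_map_inj_poly //; apply: intr_inj.
have cop : coprimep (toQ p) q.
  set g := gcdp (toQ p) q; have gq : g %| q by apply: dvdp_gcdr.
  have gp : g %| toQ p by apply: dvdp_gcdl.
  have ng : ~~ root (pQtoC g) z.
    rewrite qroot; apply/negP => qg.
    have := dvdp_leq toQ0 (dvdp_trans qg gp).
    by rewrite qPhi !sQ leqNgt sp.
  have /dvdpP[s qs] := gq.
  have : root (pQtoC s) z.
    by move: rz; rewrite qs rmorphM rootM (negPf ng) orbF.
  have q0 : q != 0 by apply: monic_neq0.
  rewrite qroot => qds; rewrite /coprimep -/g.
  have s0 : s != 0 by apply: contraNneq q0 => s0; rewrite qs s0 mul0r.
  have g0 : g != 0 by apply: contraNneq q0 => g0; rewrite qs g0 mulr0.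
  have := dvdp_leq s0 qds; rewrite qs size_mul // -(prednK (_ : 0 < size g)%N) ?size_poly_gt0 //.
  rewrite addnS /= -{2}[size s]addn0 leq_add2l leqn0 => /eqP sg.
  by rewrite sg.
have /Bezout_eq1_coprimepP[[u v] /= uv] := cop.
have [u' [a a0 ua]] := rat_poly_scale u; have [v' [b b0 vb]] := rat_poly_scale v.
exists (b *: u'), (a *: v'), (a * b); split; first by rewrite mulf_neq0.
apply: (map_inj_poly (intr_inj : injective (intr : int -> rat))) => //.
rewrite rmorphD !rmorphM /= !map_polyZ map_polyC /= -/toQ ?intrM ?rmorphM /=.
have aQ : (a%:~R : rat) != 0 by rewrite intr_eq0.
have bQ : (b%:~R : rat) != 0 by rewrite intr_eq0.
have -> : toQ u' = a%:~R *: u by rewrite ua scalerA mulfV ?scale1r.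
have -> : toQ v' = b%:~R *: v by rewrite vb scalerA mulfV ?scale1r.
rewrite -qPhi !scalerA -!scalerAl [b%:~R * _]mulrC -scalerDr uv.
by rewrite alg_polyC polyCM /toQ map_polyC.
Qed.

(** As $X^N - 1$ is the product of the $\Phi_d$ with $d \mid N$, some $\Phi_d$ vanishes at $w$; then
    $w^d = 1$, which forces $d = N$. *)
Lemma Cyclotomic_root (K : fieldType) N (w : K) :
  N.-primitive_root w -> root (map_poly intr 'Phi_N) w.
Proof.
move=> wN; have N0 := prim_order_gt0 wN.
have : root (map_poly intr ('X^N - 1)) w.
  rewrite rmorphB rmorph1 /= map_polyXn /root !hornerE ?hornerXn.
  by rewrite (prim_expr_order wN) subrr.
rewrite -prod_Cyclotomic // rmorph_prod /= /root horner_prod prodf_seq_eq0.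
case/hasP=> d dN /=; rewrite -dvdn_divisors // in dN => rd.
suff -> : N = d by [].
have d0 : (0 < d)%N := dvdn_gt0 N0 dN.
apply/eqP; rewrite eqn_dvd dN andbT (prim_order_dvd wN) -subr_eq0.
have : map_poly intr ('X^d - 1) = 'X^d - 1 :> {poly K}.
  by rewrite rmorphB rmorph1 /= map_polyXn.
rewrite -prod_Cyclotomic // rmorph_prod /= => /(congr1 (horner^~ w)).
rewrite !hornerE ?hornerXn horner_prod => <-.
by rewrite prodf_seq_eq0; apply/hasP; exists d; rewrite -?dvdn_divisors.
Qed.

(** In either field, vanishing at a primitive root amounts to vanishing of the remainder of $p$
    modulo $\Phi_N$, a condition on integer polynomials alone. *)
Lemma Cyclotomic_transfer (K : fieldType) N (w : K) (z : algC) (p : {poly int}) :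
  [pchar K] =i pred0 -> N.-primitive_root w -> N.-primitive_root z ->
  root (map_poly intr p) w = root (map_poly intr p) z.
Proof.
move=> chK wN zN.
have Pm : 'Phi_N \is monic := Cyclotomic_monic N.
pose rm := Pdiv.Ring.rmodp p 'Phi_N.
suff key (L : fieldType) (y : L) : [pchar L] =i pred0 -> N.-primitive_root y ->
    root (map_poly intr p) y = (rm == 0).
  by rewrite !key //; apply: pchar_num.
move=> chL yN; have /rootP yr := Cyclotomic_root yN.
have -> : root (map_poly intr p) y = root (map_poly intr rm) y.
  rewrite (Pdiv.RingMonic.rdivp_eq Pm p) -/rm rmorphD rmorphM /= /root.
  by rewrite hornerD hornerM yr mulr0 add0r.
have [->|r0] := eqVneq rm 0; first by rewrite rmorph0 root0.
apply/negP => /rootP ry.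
have [|u [v [a [a0 uv]]]] := Cyclotomic_coprime zN r0.
  by rewrite Pdiv.Ring.ltn_rmodp monic_neq0.
have := congr1 (fun f => (map_poly intr f).[y]) uv.
rewrite rmorphD !rmorphM /= hornerD !hornerM ry yr !mulr0 addr0 map_polyC hornerC.
by move/esym/eqP; rewrite (negPf (intr_neq0 chL a0)).
Qed.

End CyclotomicTransfer.

Lemma prim_root_exists (K : closedFieldType) N :
  [pchar K] =i pred0 -> (0 < N)%N -> exists w : K, N.-primitive_root w.
Proof.
move=> chK N0; pose p : {poly K} := 'X^N - 1.
have [rs Dp] := closed_field_poly_normal p.
have pm : p \is monic by rewrite monicXnsubC.
rewrite (monicP pm) scale1r in Dp.
have rn1 : all N.-unity_root rs by apply/allP=> z; rewrite -root_prod_XsubC -Dp.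
have sz : (N < (size rs).+1)%N by rewrite -(size_prod_XsubC rs id) -Dp size_XnsubC.
have [|w _] := hasP (has_prim_root N0 rn1 _ sz); last by exists w.
rewrite -separable_prod_XsubC -Dp separable_Xn_sub_1 //.
by move/pcharf0P: chK => ->; rewrite -lt0n.
Qed.

(** $A$ is annihilated by $X^N - 1$, which splits with distinct roots; hence it is diagonalizable
    and its eigenvalues are powers of $w$. *)
Lemma finite_order_traces (K : closedFieldType) n (A : 'M[K]_n) N (w : K) :
  N.-primitive_root w -> A ^+ N = 1%:M ->
  exists e : 'I_n -> nat,
    \tr A = \sum_i w ^+ e i /\ \tr (invmx A) = \sum_i w ^- e i.
Proof.
case: n A => [|n] A wN AN1.
  by exists (fun=> 0%N); rewrite /mxtrace !big_ord0.
have N0 := prim_order_gt0 wN.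
have [P Pu] : diagonalizable A.
  apply/diagonalizableP; exists [seq w ^+ i | i <- iota 0 N].
    rewrite map_inj_in_uniq ?iota_uniq // => i j.
    rewrite !mem_iota !add0n => /andP[_ iN] /andP[_ jN] /eqP.
    by rewrite (eq_prim_root_expr wN) !modn_small // => /eqP.
  apply: mxminpoly_min; rewrite big_map.
  have -> : \prod_(j <- iota 0 N) ('X - (w ^+ j)%:P) = 'X^N - 1.
    by rewrite -(factor_Xn_sub_1 wN) /index_iota subn0.
  by rewrite rmorphB rmorph1 /= rmorphXn /= horner_mx_X AN1 subrr.
case/diagonalizable_forPex => d /(simmxRL Pu) dA.
have Ad : A = invmx P *m diag_mx d *m P.
  by rewrite dA !mulmxA mulVmx // mul1mx mulmxKV.
have dN : diag_mx d ^+ N = 1.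
  have AX k : A ^+ k = invmx P *m diag_mx d ^+ k *m P.
    elim: k => [|k IHk]; first by rewrite !expr0 mulmx1 mulVmx.
    by rewrite !exprS IHk {1}Ad -!mulmxE !mulmxA mulmxK // .
  have := AX N; rewrite AN1 => /(congr1 (fun X => P *m X *m invmx P)).
  by rewrite mulmx1 mulmxV // !mulmxA mulmxV // mul1mx mulmxK // => <-.
have diX k : diag_mx d ^+ k = diag_mx (map_mx (fun x => x ^+ k) d).
  elim: k => [|k IHk].
    by apply/matrixP=> i j; rewrite !mxE expr0.
  rewrite exprS IHk -mulmxE mulmx_diag; congr diag_mx.
  by apply/rowP=> i; rewrite !mxE exprS.
have d1 i : d 0 i ^+ N = 1.
  by have /matrixP/(_ i i) := dN; rewrite diX !mxE eqxx.
have ex i : exists k : 'I_N, d 0 i = w ^+ k.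
  by have [k ->] := prim_rootP wN (d1 i); exists k.
have [e eP] := fin_all_exists ex.
exists (fun i => e i); split.
  rewrite Ad -mulmxA mxtrace_mulC -mulmxA mulmxV // mulmx1 mxtrace_diag.
  by apply: eq_bigr => i _; rewrite eP.
pose dV := map_mx (fun x => x^-1) d.
have dVd : diag_mx d *m diag_mx dV = 1%:M.
  rewrite mulmx_diag; apply/matrixP=> i j; rewrite !mxE.
  rewrite mulfV //; apply: contraTneq (oner_neq0 K) => d0.
  by rewrite -(d1 i) d0 expr0n gtn_eqF // eqxx.
have -> : invmx A = invmx P *m diag_mx dV *m P.
  have AV : A *m (invmx P *m diag_mx dV *m P) = 1%:M.
    rewrite Ad -!mulmxA (mulmxA P) mulmxV // mul1mx (mulmxA (diag_mx d)) dVd.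
    by rewrite mul1mx mulVmx.
  have [Au _] := mulmx1_unit AV.
  by rewrite -[LHS]mulmx1 -AV mulmxA mulVmx // mul1mx.
rewrite -mulmxA mxtrace_mulC -mulmxA mulmxV // mulmx1 mxtrace_diag.
by apply: eq_bigr => i _; rewrite mxE eP.
Qed.

(** * Positivity over the algebraic complex numbers *)

Section TracePositivity.

Import Order.TTheory Num.Theory.

Lemma root_of_unity_conj N (z : algC) : (0 < N)%N -> z ^+ N = 1 -> z^-1 = z^*.
Proof.
move=> N0 zN; have nz : `|z| = 1.
  by apply/eqP; rewrite -(pexpr_eq1 N0) ?normr_ge0 // -normrX zN normr1.
by rewrite invC_norm nz expr1n invr1 mul1r.
Qed.

(* Rescaled by a square root of \tr (F a)^-1, the matrix F a has finite order
   and its trace is a sum of roots of unity equal to that of its inverse; in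
   algC such a product of traces is a squared modulus. *)
Lemma sum_trace_inv_neq0 (K : closedFieldType) r (m : 'I_r -> nat)
    (F : forall a, 'M[K]_(m a)) M :
  [pchar K] =i pred0 -> (0 < r)%N -> (0 < M)%N ->
  (forall a, F a \in unitmx) -> (forall a, \tr (F a) = 1) ->
  (forall a, \tr (invmx (F a)) != 0) ->
  (forall a, (\tr (invmx (F a)) *: (F a *m F a)) ^+ M = 1%:M) ->
  \sum_a \tr (invmx (F a)) != 0.
Proof.
(* The exponent is doubled because $(sF)^{2M} = (s^2 F^2)^M$ for a square root $s$ of
   $\mathrm{tr}(F^{-1})$. *)
move=> chK r0 M0 Fu Ftr Ft FM; pose N := (2 * M)%N.
have N0 : (0 < N)%N by rewrite muln_gt0.
have [w wN] := prim_root_exists chK N0.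
have [z zN] := C_prim_root_exists N0.
have ex a : exists e : {ffun 'I_(m a) -> nat},
    [/\ \sum_i w ^+ e i != 0 & \tr (invmx (F a)) =
       (\sum_i w ^+ e i) * \sum_i w ^- e i].
  have /closed_rootP[s] : size ('X^2 - (\tr (invmx (F a)))%:P) != 1%N.
    by rewrite size_XnsubC.
  rewrite /root !hornerE ?hornerXn subr_eq0 => /eqP sE.
  have s0 : s != 0 by apply: contraNneq (Ft a) => s0; rewrite -sE s0 expr0n.
  have UN : (s *: F a) ^+ N = 1%:M.
    rewrite exprM expr2 -[_ * _]/(_ *m _) -scalemxAl -scalemxAr scalerA -expr2.
    by rewrite sE FM.
  have [e [e1 e2]] := finite_order_traces wN UN.
  have tU : \tr (s *: F a) = s by rewrite mxtraceZ Ftr mulr1.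
  have tUV : \tr (invmx (s *: F a)) = s.
    by rewrite invmxZ ?unitmxZ ?unitfE // mxtraceZ -sE expr2 mulKf.
  exists (finfun e); under eq_bigr do rewrite ffunE.
  under [X in _ * X]eq_bigr do rewrite ffunE.
  by rewrite -e1 -e2 tU tUV -expr2 sE.
have [e eP] := fin_all_exists ex.
pose p a : {poly int} := \sum_i 'X^(e a i).
(* The exponent $e(N-1)$ encodes the inverse $x^{-e}$ polynomially, as $x^{N-1} = x^{-1}$ at an
   $N$-th root of unity. *)
pose q a : {poly int} := \sum_i 'X^(e a i * N.-1).
have pE (L : fieldType) (x : L) a : (map_poly intr (p a)).[x] = \sum_i x ^+ e a i.
  rewrite rmorph_sum horner_sum; apply: eq_bigr => i _.
  by rewrite /= map_polyXn hornerXn.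
have qE (L : fieldType) (x : L) a : N.-primitive_root x ->
    (map_poly intr (q a)).[x] = \sum_i x ^- e a i.
  move=> xN; rewrite rmorph_sum horner_sum; apply: eq_bigr => i _.
  rewrite /= map_polyXn hornerXn mulnC exprM -exprVn; congr (_ ^+ _).
  have xu : x != 0 by rewrite (prim_root_eq0 xN) -lt0n.
  by apply: (mulfI xu); rewrite mulfV // -exprS prednK // prim_expr_order.
have PE (L : fieldType) (x : L) : N.-primitive_root x ->
    (map_poly intr (\sum_a p a * q a)).[x] =
    \sum_a (\sum_i x ^+ e a i) * \sum_i x ^- e a i.
  move=> xN; rewrite rmorph_sum horner_sum; apply: eq_bigr => a _.
  by rewrite rmorphM hornerM /= pE qE.
apply/eqP => T0.
have : root (map_poly intr (\sum_a p a * q a)) w.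
  rewrite /root PE // -[X in _ == X]T0; apply/eqP.
  by apply: eq_bigr => a _; case: (eP a).
rewrite (Cyclotomic_transfer _ chK wN zN) /root PE // => /eqP.
have cE a : (\sum_i z ^+ e a i) * \sum_i z ^- e a i = `|\sum_i z ^+ e a i| ^+ 2.
  rewrite normCK rmorph_sum; congr (_ * _); apply: eq_bigr => i _.
  rewrite (@root_of_unity_conj N) // exprAC (prim_expr_order zN) expr1n //.
(* A vanishing sum of non-negative terms has only zero terms; the one at index $0$, carried back to
   [w], contradicts the nonvanishing recorded in [eP]. *)
rewrite (eq_bigr _ (fun a _ => cE a)) => /psumr_eq0P c0.
pose a := Ordinal r0.
have /eqP : `|\sum_i z ^+ e a i| ^+ 2 = 0.
  by apply: c0 => // b _; apply: exprn_ge0.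
rewrite sqrf_eq0 normr_eq0 -pE -/(root _ z).
rewrite -(Cyclotomic_transfer _ chK wN zN) /root pE.
by case: (eP a) => /negPf ->.
Qed.

End TracePositivity.

(** * Traces and the square of the antipode *)

Section LeftMultiplication.

Variables (K : fieldType) (H : hopfType K) (V : {vspace H}).
Local Notation d := (\dim V).
Local Notation v := (vbasis V).
Local Notation S := (@antipode K H).

Definition lmul_mx (z : H) : 'M[K]_d := \matrix_(k, p) coord v k (z * v`_p).

Lemma lmul_mx_linear : linear lmul_mx.
Proof.
move=> c x y; apply/matrixP=> i j; rewrite !mxE mulrDl -scalerAl.
by rewrite linearP.
Qed.

HB.instance Definition _ :=
  GRing.isLinear.Build K H 'M[K]_d _ lmul_mx lmul_mx_linear.

Lemma vbasis_in (i : 'I_d) : v`_i \in V.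
Proof. by rewrite vbasis_mem // mem_nth ?size_tuple. Qed.

Lemma vbasis_coord (i j : 'I_d) : coord v i v`_j = (i == j)%:R.
Proof. by rewrite coord_free ?(basis_free (vbasisP V)) // eq_sym. Qed.

Hypothesis VM : (V * V <= V)%VS.

Lemma lmul_mx1 : lmul_mx 1 = 1%:M.
Proof. by apply/matrixP=> i j; rewrite !mxE mul1r vbasis_coord. Qed.

Lemma lmul_mxE x (j : 'I_d) : x \in V -> x * v`_j = \sum_k lmul_mx x k j *: v`_k.
Proof.
move=> xV; rewrite {1}(@coord_vbasis _ _ (x * v`_j) V).
  by apply: eq_bigr => k _; rewrite mxE.
by apply: (subvP VM); rewrite memv_mul ?vbasis_in.
Qed.

Lemma lmul_mxM x y : x \in V -> y \in V -> lmul_mx (x * y) = lmul_mx x *m lmul_mx y.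
Proof.
move=> xV yV; apply/matrixP=> i j; rewrite !mxE -mulrA (lmul_mxE _ yV).
rewrite mulr_sumr linear_sum; apply: eq_bigr => k _.
by rewrite -scalerAr linearZ /= !mxE mulrC.
Qed.

Variable phi : 'Hom(H, K^o).
Hypothesis phiP : integral phi.
Variables (D : 'M[H]_d) (Q : 'M[K]_d).
Hypothesis vD : corow (fun i : 'I_d => v`_i) D.
Hypothesis cD : comatrix D.
Hypothesis QD : cst H Q *m D = map_mx (fun x => S (S x)) D *m cst H Q.

(** The functional $\tau(x) = \mathrm{tr}(Q L_x)$ is invariant on $V$, which makes it the multiple
    $\tau(1)\varphi$ of the integral, and $\tau(1) = \mathrm{tr}\, Q$. *)
Lemma trace_lmul z : z \in V -> \tr (Q *m lmul_mx z) = \tr Q * (phi z : K).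
Proof.
move=> zV; pose m (a : 'I_d) := lmul_mx v`_a.
have mE (a j : 'I_d) : v`_a * v`_j = \sum_k m a k j *: v`_k by apply: lmul_mxE; apply: vbasis_in.
(* Multiplicativity of $\Delta$ on $v_a v_j$, compared at the first leg $v_k$. *)
have eq1 (a k j : 'I_d) : \sum_c \sum_p m c k p *: (D c a * D p j) = \sum_l m a l j *: D k l.
  pose w1 k' : H := \sum_c \sum_p m c k' p *: (D c a * D p j).
  pose w2 k' : H := \sum_l m a l j *: D k' l.
  apply: (@tensor_free _ _ _ _ v w1 w2 (basis_free (vbasisP V)) _ k).
  transitivity (comul (v`_a * v`_j)).
    rewrite (comulM_corow a j vD vD) /w1.
    under eq_bigr => k' _ do rewrite tens_sumr.
    rewrite exchange_big; apply: eq_bigr => c _ /=.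
    under eq_bigr => k' _ do rewrite tens_sumr.
    rewrite exchange_big; apply: eq_bigr => p _ /=.
    rewrite mE tens_suml; apply: eq_bigr => k' _.
    by rewrite tensZl tensZr.
  rewrite mE linear_sum /w2.
  under [RHS]eq_bigr => k' _ do rewrite tens_sumr.
  rewrite [RHS]exchange_big; apply: eq_bigr => l _ /=.
  rewrite linearZ /= vD scaler_sumr; apply: eq_bigr => k' _.
  by rewrite tensZr.
(* The second factor $D_{pj}$ of the previous identity is removed by multiplying with
   $S(D_{jq})$. *)
have eq2 (a k q : 'I_d) : \sum_c m c k q *: D c a =
    \sum_l \sum_j m a l j *: (D k l * S (D j q)).
  transitivity (\sum_j (\sum_c \sum_p m c k p *: (D c a * D p j)) * S (D j q)).
    under [RHS]eq_bigr => j _ do rewrite mulr_suml.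
    rewrite exchange_big; apply: eq_bigr => c _ /=.
    under eq_bigr => j _ do rewrite mulr_suml.
    rewrite exchange_big /=.
    rewrite -[LHS](sum_delta (fun p => m c k p *: D c a)).
    apply: eq_bigr => p _.
    under eq_bigr => j _ do rewrite -scalerAl -mulrA.
    rewrite -scaler_sumr -mulr_sumr (sum_antipoder p q cD).
    by case: (p == q); rewrite ?mulr1 ?mulr0 ?scale1r ?scale0r ?scaler0.
  under eq_bigr => j _ do rewrite eq1 mulr_suml.
  rewrite exchange_big; apply: eq_bigr => l _; apply: eq_bigr => j _ /=.
  by rewrite scalerAl.
pose tau (a : 'I_d) : K := \tr (Q *m m a).
have tauE a : tau a = \sum_q \sum_k Q q k * m a k q.
  by apply: eq_bigr => q _; rewrite mxE.
have SS j k : \sum_q S (S (D q k)) * S (D j q) = (j == k)%:R.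
  under eq_bigr do rewrite -antipodeM.
  rewrite -linear_sum /= (sum_antipoder j k cD).
  by case: (j == k); rewrite ?linear0 ?antipode1.
(* Invariance of $\tau$. The intertwining property of $Q$ replaces $D$ by $S^2(D)$, whose products
   with $S(D)$ in this order collapse by [SS]. *)
have eq3 a : \sum_c tau c *: D c a = tau a *: 1.
  transitivity (\sum_l \sum_j m a l j *: \sum_q (cst H Q *m D) q l * S (D j q)).
    transitivity (\sum_q \sum_k Q q k *: \sum_c m c k q *: D c a).
      under eq_bigr do rewrite tauE scaler_suml.
      rewrite exchange_big; apply: eq_bigr => q _ /=.
      under eq_bigr do rewrite scaler_suml.
      rewrite exchange_big; apply: eq_bigr => k _ /=.
      by rewrite scaler_sumr; apply: eq_bigr => c _; rewrite scalerA.
    under eq_bigr => q _ do under eq_bigr => k _ do rewrite eq2 scaler_sumr.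
    under eq_bigr => q _ do rewrite exchange_big.
    rewrite exchange_big; apply: eq_bigr => l _ /=.
    under eq_bigr => q _ do under eq_bigr => k _ do rewrite scaler_sumr.
    under eq_bigr => q _ do rewrite exchange_big.
    rewrite exchange_big; apply: eq_bigr => j _ /=.
    rewrite scaler_sumr; apply: eq_bigr => q _.
    rewrite mul_cstl mulr_suml scaler_sumr; apply: eq_bigr => k _.
    by rewrite -scalerAl !scalerA mulrC.
  rewrite QD.
  transitivity (\sum_l \sum_j (m a l j * Q j l) *: (1 : H)).
    apply: eq_bigr => l _; apply: eq_bigr => j _; rewrite -scalerA; congr (_ *: _).
    under eq_bigr => q _ do rewrite mul_cstr mulr_suml.
    rewrite exchange_big /= -[RHS](sum_delta (fun k => Q k l *: (1 : H))).
    apply: eq_bigr => k _; under eq_bigr => q _ do rewrite mxE -scalerAl.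
    rewrite -scaler_sumr SS eq_sym.
    by case: (k == j); rewrite ?scale1r ?scale0r ?scaler0.
  rewrite exchange_big tauE scaler_suml; apply: eq_bigr => q _ /=.
  by rewrite scaler_suml; apply: eq_bigr => k _; rewrite mulrC.
have eq4 (a : 'I_d) : \sum_c (phi (D c a) : K) *: v`_c = (phi v`_a : K) *: 1.
  case: phiP => _ _ /(_ v`_a) <-.
  by rewrite (sweedler_corow a vD (functional_bilinr phi)).
(* Both invariances meet in $\sum_c \tau(v_c) \varphi(D_{ca})$: summing over the left one gives
   $\tau(v_a)$, over the right one $\varphi(v_a)\tau(1)$. *)
have key a : tau a = \tr Q * (phi v`_a : K).
  have phi1 : phi 1 = 1 by case: phiP.
  have := congr1 phi (eq3 a); rewrite linearZ /= phi1 [_ *: _]mulr1 => <-.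
  have := congr1 (fun x => \tr (Q *m lmul_mx x)) (eq4 a).
  rewrite linearZ /= lmul_mx1 -scalemxAr mulmx1 mxtraceZ mulrC => <-.
  rewrite !linear_sum; apply: eq_bigr => c _ /=.
  by rewrite !linearZ /= -?scalemxAr ?mxtraceZ mulrC.
rewrite (coord_vbasis zV) !linear_sum mulr_sumr; apply: eq_bigr => a _ /=.
rewrite !linearZ /= -?scalemxAr ?mxtraceZ -/(m a) -/(tau a) key.
by rewrite mulrCA.
Qed.

End LeftMultiplication.

Lemma natr_inj_char0 (K : fieldType) (p q : nat) :
  [pchar K] =i pred0 -> (p%:R : K) = q%:R -> p = q.
Proof.
move=> /pcharf0P ch; wlog pq : p q / (p <= q)%N.
  by move=> th; case/orP: (leq_total p q) => ? ?; [|apply/esym]; apply: th.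
move=> eqpq; have := ch (q - p)%N; rewrite natrB // eqpq subrr eqxx => /esym.
by rewrite subn_eq0 => qp; apply/eqP; rewrite eqn_leq pq.
Qed.

Lemma trace_idempotent (K : fieldType) n (A : 'M[K]_n) :
  A *m A = A -> \tr A = (\rank A)%:R.
Proof.
move=> AA; have rc : row_base A *m col_base A = 1%:M.
  apply: (row_free_inj (row_base_free A)).
  apply: (row_full_inj (col_base_full A)).
  by rewrite mul1mx mulmx_base mulmxA mulmxA mulmx_base -mulmxA mulmx_base.
by rewrite -{1}(mulmx_base A) mxtrace_mulC rc mxtrace_scalar.
Qed.

(* The trace of an involution R is n - 2a with a the rank of (1 - R) / 2; if it
   is n times that of R on the image of a commuting idempotent, then n divides
   2a, hence a is 0 or n. *)
Lemma involution_trace (K : fieldType) n (R E : 'M[K]_n) :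
  [pchar K] =i pred0 -> R *m R = 1%:M -> E *m E = E -> R *m E = E *m R ->
  \tr R = n%:R * \tr (R *m E) -> \tr R != 0 -> R = 1%:M \/ R = - 1%:M.
Proof.
move=> chK RR EE RE trR tr0.
have two : (2%:R : K) != 0 by move/pcharf0P: chK => ->.
pose h : K := 2%:R^-1.
have hh : h + h = 1 by rewrite -mulr2n -mulr_natl mulfV.
pose A := h *: (1%:M - R).
have [B Bdef] : exists B, B = 1%:M - A by exists (1%:M - A).
have A2 : A + A = 1%:M - R by rewrite -scalerDl hh scale1r.
have AR : A *m R = - A.
  by rewrite -scalemxAl mulmxBl mul1mx RR -scalerN opprB.
have AA : A *m A = A.
  have : A *m A + A *m A = A + A by rewrite -mulmxDr A2 mulmxBr mulmx1 AR opprK.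
  by rewrite -!mulr2n -!scaler_nat => /(scalerI two).
have RA : R = B - A by rewrite Bdef -addrA -opprD A2 opprB addrC subrK.
have BB : B *m B = B.
  by rewrite Bdef mulmxBl !mulmxBr !mul1mx mulmx1 AA subrr subr0.
have AE : A *m E = E *m A.
  by rewrite -scalemxAl -scalemxAr mulmxBl mulmxBr RE mul1mx mulmx1.
have BE : B *m E = E *m B by rewrite Bdef mulmxBl mulmxBr AE mul1mx mulmx1.
have idem X : X *m X = X -> X *m E = E *m X -> (X *m E) *m (X *m E) = X *m E.
  by move=> XX XE; rewrite {1}XE -mulmxA (mulmxA X) XX mulmxA -XE -mulmxA EE.
have := trR; rewrite RA mulmxBl !raddfB /= {1}Bdef raddfB /= mxtrace1.
rewrite (trace_idempotent AA) (trace_idempotent (idem _ AA AE)).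
rewrite (trace_idempotent (idem _ BB BE)).
set a := \rank A; set b := \rank _; set c := \rank _ => eqn.
have eqN : (n + n * c = n * b + (a + a))%N.
  apply: (natr_inj_char0 chK); rewrite !natrD !natrM.
  move/eqP: eqn; rewrite mulrBr -addrA -opprD subr_eq addrAC eq_sym subr_eq.
  by move/eqP.
have na : (n : nat) != (a + a)%N.
  apply: contra tr0 => /eqP na; rewrite RA Bdef !raddfB /= mxtrace1.
  by rewrite (trace_idempotent AA) -/a na natrD addrK subrr.
have an : (a <= n)%N by apply: rank_leq_row.
have /dvdnP[k ak] : (n %| a + a)%N.
  by rewrite -(dvdn_addr _ (dvdn_mulr b (dvdnn n))) -eqN dvdn_add ?dvdn_mulr.
have [a0|a0] := posnP a.
  left; move/eqP: a0; rewrite mxrank_eq0 => /eqP A0.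
  by rewrite Bdef A0 !subr0.
have : (k * n <= 2 * n)%N by rewrite -ak addnn -mul2n leq_mul2l an.
have n0 : (0 < n)%N by apply: leq_trans an.
rewrite leq_pmul2r //; case: k ak => [|[|[|]]] //= ak _.
- by move: a0; have := ak; rewrite mul0n => /eqP; rewrite addn_eq0 => /andP[/eqP->].
- by rewrite ak mul1n eqxx in na.
right; have an2 : a = n.
  by apply/eqP; rewrite -(eqn_pmul2l (_ : 0 < 2)%N) // -ak addnn mul2n.
have Au : A \in unitmx by rewrite -row_full_unit /row_full -/a an2.
have A1 : A = 1%:M by rewrite -[LHS](mulKmx Au) AA mulVmx.
by rewrite Bdef A1 subrr sub0r.
Qed.

(** * The square of the antipode is the identity *)

Section SquareAntipode.

Variables (K : closedFieldType) (H : hopfType K) (phi : 'Hom(H, K^o)).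
Variables (r : nat) (m : 'I_r -> nat) (D : forall a, 'M[H]_(m a)).
Variable F : forall a, 'M[K]_(m a).
Arguments D : clear implicits.
Arguments F : clear implicits.
Hypothesis chK : [pchar K] =i pred0.
Hypothesis phiP : integral phi.
Hypothesis bs : block_system phi D F.
Local Notation S := (@antipode K H).
Local Notation t a := (\tr (invmx (F a))).
Local Notation n := (\dim {:H}).
Local Notation b := (vbasis {:H}).

Definition endmx (g : 'End(H)) : 'M[K]_n := \matrix_(i, j) coord b i (g b`_j).

Lemma endmx_comp (f g : 'End(H)) : endmx (f \o g)%VF = endmx f *m endmx g.
Proof.
apply/matrixP=> i j; rewrite !mxE lfunE /= {1}(coord_vbasis (memvf (g b`_j))).
rewrite !linear_sum; apply: eq_bigr => k _ /=.
by rewrite !linearZ /= !mxE mulrC.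
Qed.

Lemma endmx1 : endmx \1%VF = 1%:M.
Proof. by apply/matrixP=> i j; rewrite !mxE lfunE vbasis_coord. Qed.

Lemma endmx_inj : injective endmx.
Proof.
move=> f g fg; apply/lfunP=> x; rewrite (coord_vbasis (memvf x)) !linear_sum.
apply: eq_bigr => j _; rewrite !linearZ; congr (_ *: _).
rewrite [LHS](coord_vbasis (memvf _)) [RHS](coord_vbasis (memvf _)).
by apply: eq_bigr => i _; have /matrixP/(_ i j) := fg; rewrite !mxE => ->.
Qed.

Lemma endmx_lmul (g : 'End(H)) x z :
  (forall y, g (x * y) = z * g y) ->
  endmx g *m lmul_mx {:H} x = lmul_mx {:H} z *m endmx g.
Proof.
move=> gx; apply/matrixP=> i j; rewrite !mxE.
transitivity (coord b i (g (x * b`_j))).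
  rewrite (coord_vbasis (memvf (x * b`_j))) !linear_sum; apply: eq_bigr => k _ /=.
  by rewrite !linearZ /= !mxE mulrC.
rewrite gx (coord_vbasis (memvf (g b`_j))) mulr_sumr linear_sum.
by apply: eq_bigr => k _ /=; rewrite -scalerAr linearZ /= !mxE mulrC.
Qed.

(** The entries of the blocks and the functionals [block_coord] are dual bases, so the trace can be
    read off there. *)
Lemma trace_endmx_blocks (g : 'End(H)) :
  \tr (endmx g) = \sum_a \sum_i \sum_j block_coord phi D F a i j (g (D a i j)).
Proof.
transitivity (\sum_(l < n) \sum_a \sum_i \sum_j
    block_coord phi D F a i j b`_l * coord b l (g (D a i j))).
  apply: eq_bigr => l _; rewrite mxE {1}(block_coordE bs b`_l) !linear_sum.
  apply: eq_bigr => a _; rewrite !linear_sum; apply: eq_bigr => i _.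
  by rewrite !linear_sum; apply: eq_bigr => j _; rewrite !linearZ.
rewrite exchange_big; apply: eq_bigr => a _ /=.
rewrite exchange_big; apply: eq_bigr => i _ /=.
rewrite exchange_big; apply: eq_bigr => j _ /=.
rewrite {2}(coord_vbasis (memvf (g (D a i j)))) linear_sum.
by apply: eq_bigr => l _; rewrite linearZ mulrC.
Qed.

Local Notation Si2 := (S^-1 \o S^-1)%VF.

Lemma antipode_lker0 : lker S == 0%VS.
Proof. by apply/lker0P; apply: antipode_inj bs. Qed.

Lemma antipode2K x : Si2 (S (S x)) = x.
Proof. by rewrite lfunE /= !lker0_lfunK ?antipode_lker0. Qed.

Lemma endmx_antipode2K : endmx Si2 *m endmx (S \o S)%VF = 1%:M.
Proof.
rewrite -endmx_comp -endmx1; congr endmx; apply/lfunP=> x.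
by rewrite comp_lfunE [X in Si2 X]comp_lfunE antipode2K id_lfunE.
Qed.

Lemma antipode2VK x : S (S (Si2 x)) = x.
Proof. by rewrite lfunE /= !lker0_lfunVK ?antipode_lker0. Qed.

Lemma antipode2_inv_mul x y : Si2 (x * y) = Si2 x * Si2 y.
Proof.
by rewrite -[x in LHS]antipode2VK -[y in LHS]antipode2VK -!antipodeM antipode2K.
Qed.

Lemma antipode2_conj p q l (A : 'M[K]_(p, q)) (X : 'M[H]_q) (B : 'M[K]_(q, l)) :
  map_mx (fun x => S (S x)) (cst H A *m X *m cst H B) =
  cst H A *m map_mx (fun x => S (S x)) X *m cst H B.
Proof.
apply/matrixP=> i j; rewrite [LHS]mxE !mul_cstr !linear_sum.
apply: eq_bigr => k _ /=; rewrite !linearZ; congr (_ *: _).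
rewrite !mul_cstl !linear_sum; apply: eq_bigr => k' _ /=.
by rewrite !linearZ /= mxE.
Qed.

Lemma antipode2_invD a i j :
  Si2 (D a i j) = (cst H (invmx (F a)) *m D a *m cst H (F a)) i j.
Proof.
have Fu := block_unit bs a.
have S2 : map_mx (fun x => S (S x)) (cst H (invmx (F a)) *m D a *m cst H (F a)) = D a.
  rewrite antipode2_conj.
  have -> : map_mx (fun x => S (S x)) (D a) = cst H (F a) *m D a *m cst H (invmx (F a)).
    by apply/matrixP=> k l; rewrite mxE (block_S2 bs).
  rewrite !mulmxA -cstM mulVmx // cst1 mul1mx -mulmxA -cstM mulVmx // cst1.
  by rewrite mulmx1.
by have /matrixP/(_ i j) := S2; rewrite mxE => {1}<-; rewrite antipode2K.
Qed.

(** On block $a$ the map is conjugation by $F_a^{-1}$, of trace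
    $\mathrm{tr}(F_a^{-1})\,\mathrm{tr}(F_a)$, and the second factor is $1$. *)
Lemma trace_antipode2_inv : \tr (endmx Si2) = \sum_a t a.
Proof.
rewrite trace_endmx_blocks; apply: eq_bigr => a _.
transitivity (\tr (invmx (F a)) * \tr (F a)); last by rewrite (block_tr bs) mulr1.
rewrite mulr_suml; apply: eq_bigr => i _; rewrite mulr_sumr; apply: eq_bigr => j _.
rewrite antipode2_invD /block_coord.
transitivity (block_coord phi D F a i j
   (\sum_q \sum_p (F a q j * invmx (F a) i p) *: D a p q)).
  rewrite /block_coord; apply: eq_bigr => k _; rewrite mul_cstr.
  congr (_ * phi (_ * _)); apply: eq_bigr => q _; rewrite mul_cstl scaler_sumr.
  by apply: eq_bigr => p _; rewrite scalerA.
rewrite linear_sum (bigD1 j) //= [X in _ + X]big1 ?addr0; last first.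
  move=> q qj; rewrite linear_sum big1 // => p _; rewrite linearZ /=.
  by rewrite (block_coord_same bs) (negPf qj) !mulr0 scaler0.
rewrite linear_sum (bigD1 i) //= big1 ?addr0 => [|p pi]; last first.
  by rewrite linearZ /= (block_coord_same bs) (negPf pi) !mul0r scaler0.
by rewrite linearZ /= (block_coord_same bs) !eqxx mulr1 [_ *: _]mulr1 mulrC.
Qed.

Lemma trace_antipode2_inv_neq0 : \tr (endmx Si2) != 0.
Proof.
rewrite trace_antipode2_inv; have [M M0 FM] := block_finite_order bs.
apply: sum_trace_inv_neq0 FM => //.
- case: (posnP r) => // r0; have [M'] := block_span bs 1.
  by rewrite big1 => [/eqP|a _]; [rewrite oner_eq0 | have := ltn_ord a; rewrite {2}r0].
- exact: block_unit bs.
- exact: block_tr bs.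
- exact: block_trV bs.
Qed.

Variable C : 'M[H]_n.
Hypothesis bC : corow (fun i : 'I_n => b`_i) C.
Hypothesis cC : comatrix C.
Local Notation S2C := (map_mx (fun x : H => S (S x)) C).

(** $S^2$ is a coalgebra map, so its matrix $R$ satisfies $C R = R\, S^2(C)$; passing to the inverse
    gives the intertwiner required by [trace_lmul]. *)
Lemma intertwiner_antipode2 : cst H (endmx Si2) *m C = S2C *m cst H (endmx Si2).
Proof.
(* The comultiplication of $S^2$ is known on entries of comatrices only, so $b_i$ is first written
   through the counit and the entries of [C]. *)
have S2b (i : 'I_n) : comul (S (S b`_i)) = \sum_(j < n) tens (S (S b`_j)) (S2C j i).
  have bE (j : 'I_n) : S (S b`_j) = \sum_(l < n) (counit b`_l : K) *: S (S (C l j)).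
    rewrite -{1}[b`_j]sweedler_counitl (sweedler_corow j bC (@counit_bilinear K H)).
    by rewrite !linear_sum; apply: eq_bigr => l _; rewrite !linearZ.
  rewrite bE linear_sum; under [RHS]eq_bigr do rewrite bE tens_suml.
  rewrite [RHS]exchange_big; apply: eq_bigr => l _ /=.
  rewrite linearZ /=; have := (comatrix_antipode2 cC).1 l i; rewrite mxE => ->.
  by rewrite scaler_sumr; apply: eq_bigr => j _; rewrite tensZl [S2C l j]mxE.
pose R := endmx (S \o S)%VF.
have bR (j : 'I_n) : S (S b`_j) = \sum_(l < n) R l j *: b`_l.
  rewrite (coord_vbasis (memvf (S (S b`_j)))); apply: eq_bigr => l _.
  by rewrite mxE lfunE.
have CR : C *m cst H R = cst H R *m S2C.
  apply/matrixP=> l i; rewrite mul_cstr mul_cstl.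
  pose w1 l' : H := \sum_j R j i *: C l' j.
  pose w2 l' : H := \sum_j R l' j *: S2C j i.
  apply: (@tensor_free _ _ _ _ b w1 w2 (basis_free (vbasisP _)) _ l).
  transitivity (comul (S (S b`_i))).
    rewrite bR linear_sum /w1; under eq_bigr do rewrite tens_sumr.
    rewrite exchange_big; apply: eq_bigr => j _ /=.
    rewrite linearZ /= bC scaler_sumr; apply: eq_bigr => k _.
    by rewrite tensZr.
  rewrite S2b /w2; under [RHS]eq_bigr do rewrite tens_sumr.
  rewrite [RHS]exchange_big; apply: eq_bigr => j _ /=.
  by rewrite bR tens_suml; apply: eq_bigr => k _; rewrite tensZl tensZr.
have QR : endmx Si2 *m R = 1%:M by apply: endmx_antipode2K.
have RQ : R *m endmx Si2 = 1%:M by apply: mulmx1C.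
rewrite -[LHS]mulmx1 -cst1 -RQ cstM !mulmxA -(mulmxA _ C) CR.
by rewrite !mulmxA -cstM QR cst1 mul1mx.
Qed.

(** By [trace_lmul], $\varphi(z)$ is the trace of $S^{-2} L_z$ up to a nonzero factor. Since $S^{-2}
    L_x = L_{S^{-2}(x)} S^{-2}$, cyclicity of the trace shows $S^{-2}$ to be the Nakayama
    automorphism. *)
Lemma integral_trace x y : phi (x * y) = phi (y * Si2 x).
Proof.
have VM : ({:H} * {:H} <= {:H})%VS by apply: subvf.
have tr z : \tr (endmx Si2 *m lmul_mx {:H} z) = \tr (endmx Si2) * (phi z : K).
  by apply: (trace_lmul VM phiP bC cC intertwiner_antipode2); apply: memvf.
apply: (mulfI trace_antipode2_inv_neq0); rewrite -!tr.
rewrite !(lmul_mxM VM (memvf _) (memvf _)) mulmxA (endmx_lmul (z := Si2 x)).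
  by rewrite -mulmxA mxtrace_mulC mulmxA.
by move=> z; apply: antipode2_inv_mul.
Qed.

Lemma block_square a : t a *: (F a *m F a) = 1%:M.
Proof.
have Fu := block_unit bs a.
have /existsP[k /existsP[j Fkj]] : [exists k, [exists j, F a k j != 0]].
  apply: contraT; rewrite negb_exists => /forallP F0.
  have := block_tr bs a; rewrite /mxtrace big1 => [/eqP|i _].
    by rewrite eq_sym oner_eq0.
  by have := F0 i; rewrite negb_exists => /forallP/(_ i); rewrite negbK => /eqP.
(* The integral of $D_{ij} S(D_{kl})$ is computed directly and after moving $D_{ij}$ to the right as
   $S^{-2}(D_{ij})$; the common factor $F_{kj} \ne 0$ cancels. *)
have VV : (t a)^-1 *: (invmx (F a) *m invmx (F a)) = 1%:M.
  apply/matrixP=> i l; apply: (mulIf Fkj).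
  have := integral_trace (D a i j) (S (D a k l)).
  rewrite (block_orthl bs) antipode2_invD (block_orthr_conj bs) => eqx.
  by rewrite [X in _ = X * _]mxE eqx [X in X * _ = _]mxE mulrC.
rewrite -[_ *: _]mulmx1 -VV -scalemxAl -scalemxAr scalerA mulfV ?(block_trV bs) //.
by rewrite scale1r -mulmxA (mulmxA (F a) (invmx _)) mulmxV // mul1mx mulmxV.
Qed.

(** $S^4$ is conjugation by $F_a^2$ on block $a$, and this matrix is scalar. *)
Lemma antipode4 x : S (S (S (S x))) = x.
Proof.
move: x; apply: (block_ind bs) => [c x y Px Py|a i j].
  by rewrite !linearP /= Px Py.
have FF : F a *m F a = (t a)^-1%:M.
  by rewrite -scalemx1 -(block_square a) scalerA mulVf ?(block_trV bs) // scale1r.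
have VV : invmx (F a) *m invmx (F a) = (t a)%:M.
  rewrite -[LHS]mulmx1 -(block_square a) -scalemxAr mulmxA -(mulmxA (invmx _)).
  have Fu := block_unit bs a.
  by rewrite mulVmx // mulmx1 mulVmx // scalemx1.
have S2D : map_mx (fun x => S (S x)) (D a) = cst H (F a) *m D a *m cst H (invmx (F a)).
  by apply/matrixP=> k l; rewrite mxE (block_S2 bs).
have -> : S (S (S (S (D a i j)))) =
  map_mx (fun x => S (S x)) (map_mx (fun x => S (S x)) (D a)) i j by rewrite !mxE.
rewrite S2D antipode2_conj S2D !mulmxA -cstM FF -mulmxA -cstM VV.
rewrite mul_cstr (bigD1 j) //= big1 ?addr0 => [|k kj]; last first.
  by rewrite mxE (negPf kj) scale0r.
rewrite mul_cstl (bigD1 i) //= big1 ?addr0 => [|k ki]; last first.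
  by rewrite mxE eq_sym (negPf ki) scale0r.
by rewrite !mxE !eqxx scalerA mulfV ?(block_trV bs) // scale1r.
Qed.

(** The tensor square of the regular comodule is a sum of $n$ copies of it. In [eq1] the matrix with
    entries $P(C_{kp})_{ql}$ intertwines $C \otimes C$ with $1 \otimes C$; [SC] and [CS] give its
    inverse through the antipode, and traces are compared. *)
Lemma trace_comatrix_square : (\tr C) * (\tr C) = n%:R *: \tr C.
Proof.
have VM : ({:H} * {:H} <= {:H})%VS by apply: subvf.
pose P x := lmul_mx {:H} x.
have PM x y : P (x * y) = P x *m P y by apply: lmul_mxM; rewrite ?memvf.
have PE x (j : 'I_n) : x * b`_j = \sum_k P x k j *: b`_k.
  by apply: lmul_mxE; rewrite ?memvf.
have P1 : P 1 = 1%:M by apply: lmul_mx1.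
have eq1 k i (q j : 'I_n) :
    \sum_p \sum_l P (C k p) q l *: (C p i * C l j) = \sum_l P (C k i) l j *: C q l.
  pose w1 q' : H := \sum_p \sum_l P (C k p) q' l *: (C p i * C l j).
  pose w2 q' : H := \sum_l P (C k i) l j *: C q' l.
  apply: (@tensor_free _ _ _ _ b w1 w2 (basis_free (vbasisP _)) _ q).
  transitivity (comul (C k i * b`_j)).
    rewrite (comulM_corow i j (cC.1 k) bC) /w1.
    under eq_bigr do rewrite tens_sumr.
    rewrite exchange_big; apply: eq_bigr => p _ /=.
    under eq_bigr do rewrite tens_sumr.
    rewrite exchange_big; apply: eq_bigr => l _ /=.
    rewrite PE tens_suml; apply: eq_bigr => q' _.
    by rewrite tensZl tensZr.
  rewrite PE linear_sum /w2; under [RHS]eq_bigr do rewrite tens_sumr.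
  rewrite [RHS]exchange_big; apply: eq_bigr => l _ /=.
  rewrite linearZ /= bC scaler_sumr; apply: eq_bigr => q' _.
  by rewrite tensZr.
have SC p p' : \sum_k P (S (C p k)) *m P (C k p') = ((p == p')%:R : K)%:M.
  under eq_bigr do rewrite -PM.
  rewrite -linear_sum /= (sum_antipodel p p' cC).
  by case: (p == p'); rewrite ?P1 // raddf0 -scalemx1 scale0r.
have CS p p' : \sum_k P (C p k) *m P (S (C k p')) = ((p == p')%:R : K)%:M.
  under eq_bigr do rewrite -PM.
  rewrite -linear_sum /= (sum_antipoder p p' cC).
  by case: (p == p'); rewrite ?P1 // raddf0 -scalemx1 scale0r.
have CC p i (l j : 'I_n) : C p i * C l j =
    \sum_k \sum_q P (S (C p k)) l q *: \sum_q' P (C k i) q' j *: C q q'.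
  under eq_bigr => k _ do under eq_bigr => q _ do rewrite -eq1 scaler_sumr.
  under eq_bigr => k _ do rewrite exchange_big.
  rewrite exchange_big /= -[LHS](sum_delta (fun p' => C p' i * C l j)).
  apply: eq_bigr => p' _.
  under eq_bigr => k _ do under eq_bigr => q _ do rewrite scaler_sumr.
  under eq_bigr => k _ do rewrite exchange_big.
  rewrite exchange_big /= -[C p' i * _](sum_delta (fun l' => C p' i * C l' j)).
  rewrite scaler_sumr; apply: eq_bigr => l' _.
  have /matrixP/(_ l l') := SC p p'; rewrite summxE !mxE => eqk.
  transitivity (((p == p')%:R *+ (l == l') : K) *: (C p' i * C l' j)).
    rewrite scalerA [p' == p]eq_sym [l' == l]eq_sym; congr (_ *: _).
    by rewrite mulr_natr.
  rewrite -eqk scaler_suml; apply: eq_bigr => k _.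
  by rewrite mxE scaler_suml; apply: eq_bigr => q _; rewrite scalerA.
transitivity (\sum_k \sum_q \sum_q'
   (\sum_p \sum_l P (C k p) q' l * P (S (C p k)) l q) *: C q q').
  rewrite /mxtrace mulr_suml.
  under eq_bigr => p _ do rewrite mulr_sumr.
  under eq_bigr => p _ do under eq_bigr => l _ do rewrite CC.
  under eq_bigr => p _ do rewrite exchange_big.
  rewrite exchange_big; apply: eq_bigr => k _ /=.
  under eq_bigr => p _ do rewrite exchange_big.
  rewrite exchange_big; apply: eq_bigr => q _ /=.
  under eq_bigr => p _ do under eq_bigr => l _ do rewrite scaler_sumr.
  under eq_bigr => p _ do rewrite exchange_big.
  rewrite exchange_big; apply: eq_bigr => q' _ /=.
  rewrite scaler_suml; apply: eq_bigr => p _.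
  rewrite scaler_suml; apply: eq_bigr => l _.
  by rewrite scalerA mulrC.
transitivity (\sum_(k < n) \tr C); last first.
  by rewrite sumr_const card_ord scaler_nat.
apply: eq_bigr => k _; apply: eq_bigr => q _.
rewrite -[RHS](sum_delta (fun q' => C q q')); apply: eq_bigr => q' _.
congr (_ *: _); have /matrixP/(_ q' q) := CS k k.
rewrite summxE !mxE eqxx => <-; apply: eq_bigr => p _.
by rewrite mxE.
Qed.

(** Invariance gives $\varphi(C_{jj}) = \varphi(b_j) c_j(1)$ with $c_j$ the $j$-th coordinate, and
    these add up to $\varphi(1)$. *)
Lemma integral_trace_comatrix : phi (\tr C) = 1.
Proof.
have [phi1 _ phir] := phiP.
have key (j : 'I_n) : phi (C j j) = (phi b`_j : K) * coord b j 1.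
  have := phir b`_j; rewrite (sweedler_corow j bC (functional_bilinr phi)).
  move/(congr1 (coord b j)); rewrite linear_sum (bigD1 j) //= big1 ?addr0 => [|k kj].
    by rewrite !linearZ /= vbasis_coord eqxx mulr1.
  by rewrite linearZ /= vbasis_coord eq_sym (negPf kj) mulr0.
rewrite linear_sum -phi1 [X in _ = phi X](coord_vbasis (memvf 1)) linear_sum.
by apply: eq_bigr => j _ /=; rewrite key linearZ mulrC.
Qed.

(** $S^2(C)$ is conjugate to $C$ by a matrix of scalars, so the traces agree even over the
    noncommutative $H$. *)
Lemma antipode2_trace_comatrix : S (S (\tr C)) = \tr C.
Proof.
pose R := endmx (S \o S)%VF.
have QR : endmx Si2 *m R = 1%:M by apply: endmx_antipode2K.
have RQ : R *m endmx Si2 = 1%:M by apply: mulmx1C.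
have S2E : S2C = cst H (endmx Si2) *m C *m cst H R.
  by rewrite intertwiner_antipode2 -mulmxA -cstM QR cst1 mulmx1.
transitivity (\tr S2C).
  by rewrite !linear_sum; apply: eq_bigr => j _; rewrite mxE.
rewrite S2E; transitivity (\tr (cst H (R *m endmx Si2) *m C)); last first.
  by rewrite RQ cst1 mul1mx.
rewrite cstM -[in RHS]mulmxA; set X := cst H (endmx Si2) *m C.
rewrite /mxtrace; under eq_bigr do rewrite mul_cstr.
by rewrite exchange_big; apply: eq_bigr => k _; rewrite mul_cstl.
Qed.

(** Left multiplication by the idempotent $e = \mathrm{tr}(C)/n$ commutes with the involution $R =
    S^2 = S^{-2}$, and $\mathrm{tr}(RE) = \mathrm{tr}(R)\varphi(e) = \mathrm{tr}(R)/n$. Thus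
    [involution_trace] applies. *)
Lemma antipode_involutive_of_blocks x : S (S x) = x.
Proof.
have n0 : (n%:R : K) != 0.
  move/pcharf0P: chK => ->; rewrite dimv_eq0; apply: contraTneq (memvf (1 : H)) => ->.
  by rewrite memv0 oner_neq0.
have Si2E y : Si2 y = S (S y) by rewrite -{1}[y]antipode4 antipode2K.
pose R := endmx (S \o S)%VF.
have RSi : R = endmx Si2.
  by congr endmx; apply/lfunP=> y; rewrite Si2E lfunE.
have VM : ({:H} * {:H} <= {:H})%VS by apply: subvf.
pose e := (n%:R^-1 : K) *: \tr C.
pose E := lmul_mx {:H} e.
have ee : e * e = e.
  rewrite -scalerAl -scalerAr trace_comatrix_square !scalerA.
  by rewrite mulfVK.
have RR : R *m R = 1%:M.
  rewrite -endmx_comp -endmx1; congr endmx; apply/lfunP=> y.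
  by rewrite comp_lfunE !comp_lfunE id_lfunE antipode4.
have EE : E *m E = E by rewrite -lmul_mxM ?memvf // ee.
have RE : R *m E = E *m R.
  apply: endmx_lmul => y; rewrite !comp_lfunE /= !antipodeM; congr (_ * _).
  by rewrite !linearZ /= antipode2_trace_comatrix.
have trRE : \tr R = n%:R * \tr (R *m E).
  rewrite RSi /E (trace_lmul VM phiP bC cC intertwiner_antipode2 (memvf _)).
  by rewrite linearZ /= integral_trace_comatrix [_ *: _]mulr1 mulrCA mulfV ?mulr1.
have tr0 : \tr R != 0 by rewrite RSi trace_antipode2_inv_neq0.
have [R1|R1] := involution_trace chK RR EE RE trRE tr0.
  have := @endmx_inj (S \o S)%VF \1%VF; rewrite endmx1 -R1 => /(_ erefl).
  by move/lfunP/(_ x); rewrite comp_lfunE id_lfunE.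
(* The case $R = -1$ would give $S^2(1) = -1$, against $S(1) = 1$ in characteristic zero. *)
have := @endmx_inj (S \o S)%VF (- \1)%VF.
have -> : endmx (- \1)%VF = R.
  by rewrite R1 -endmx1; apply/matrixP=> i j; rewrite !mxE opp_lfunE linearN.
move=> /(_ erefl)/lfunP/(_ 1); rewrite comp_lfunE opp_lfunE id_lfunE !antipode1.
move/eqP; rewrite -subr_eq0 opprK -mulr2n -scaler_nat scaler_eq0 oner_eq0 orbF.
by move/pcharf0P: chK => ->.
Qed.

End SquareAntipode.

(* A theorem of Larson and Radford. *)
Theorem antipode_involutive (K : closedFieldType) (H : hopfType K) :
  [pchar K] =i pred0 -> cosemisimple H ->
  forall x : H, antipode (antipode x) = x.
Proof.
move=> chK csH; have [phi phiP] := integral_exists csH.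
have [r [m [D [F bs]]]] := block_system_exists phiP csH.
have := @coideal_comatrix K H {:H} {:H}; rewrite tensv_full subvf => -[//|C [bC cC _]].
exact: (antipode_involutive_of_blocks chK phiP bs bC cC).
Qed.

(** * Partial actions and coideal subalgebras *)

Section PartialActions.

Variables (K : fieldType) (H : hopfType K).
Implicit Types lambda mu : 'Hom(H, K^o).
Local Notation S := (@antipode K H).

Lemma smash_mapD lambda m (D : 'M[H]_m) i j : comatrix D ->
  smash_map lambda (D i j) = \sum_k (lambda (D i k) : K) *: D k j.
Proof.
by move=> cD; apply: sweedler_comatrix cD _; apply: functional_bilinl.
Qed.

Lemma partial_actionD lambda m (D : 'M[H]_m) i j k :
  partial_action lambda -> comatrix D ->
  \sum_a (lambda (D i a) : K) * (lambda (D a j * k) : K) =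
    (lambda (D i j) : K) * lambda k.
Proof.
move=> [_ /(_ (D i j) k)] + cD; rewrite (sweedler_comatrix i j cD) => [->//|].
split=> [w|u] c x y /=; first by rewrite linearP mulrDl -scalerAl.
by rewrite mulrDl -scalerAl linearP mulrDr -scalerAr.
Qed.

Lemma smash_map1 lambda : partial_action lambda -> smash_map lambda 1 = 1.
Proof.
case=> l1 _; rewrite /smash_map /sweedler comul1 tlift_bilin ?l1 ?scale1r //.
exact: functional_bilinl.
Qed.

(** For $E$ = [smash_map lambda], the axiom of a partial action contracts the first legs of $E(x)y$;
    this is linearity of $E$ over its image. *)
Lemma smash_mapM lambda x y : partial_action lambda ->
  smash_map lambda (smash_map lambda x * y) = smash_map lambda x * smash_map lambda y.
Proof.
move=> pal; move: x; apply: comatrix_ind => [c x x' Px Px'|m D cD i j].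
  by rewrite linearP !mulrDl -!scalerAl linearP /= Px Px'.
move: y; apply: comatrix_ind => [c x x' Px Px'|p E cE k l].
  by rewrite [in RHS]linearP !mulrDr -!scalerAr linearP /= Px Px'.
rewrite !smash_mapD // mulr_suml linear_sum.
under eq_bigr => a _ do rewrite -scalerAl linearZ /= {1}/smash_map
  (sweedlerM_corow _ _ (cD.1 a) (cE.1 k) (functional_bilinl lambda)) scaler_sumr.
rewrite exchange_big mulr_suml; apply: eq_bigr => b _ /=.
under eq_bigr => a _ do rewrite scaler_sumr.
rewrite exchange_big mulr_sumr; apply: eq_bigr => c _ /=.
under eq_bigr => a _ do rewrite scalerA.
rewrite -scaler_suml (partial_actionD i b _ pal cD).
by rewrite -scalerAl -scalerAr scalerA.
Qed.

Lemma memv_Hlambda lambda x : smash_map lambda x \in Hlambda lambda.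
Proof. by apply/HlambdaP; exists x. Qed.

Lemma Hlambda_coideal_subalgebra lambda :
  partial_action lambda -> right_coideal_subalgebra (Hlambda lambda).
Proof.
move=> pal; split.
- by rewrite -(smash_map1 pal) memv_Hlambda.
- apply/prodvP=> _ _ /HlambdaP[x ->] /HlambdaP[y ->].
  by rewrite -!/(smash_map _ _) -smash_mapM // memv_Hlambda.
- apply/subvP=> _ /memv_imgP[_ /HlambdaP[x ->] ->].
  rewrite -/(smash_map _ _); move: x.
  apply: comatrix_ind => [c x y Px Py|m D cD i j].
    by rewrite !linearP /=; apply: memvD => //; apply: memvZ.
  rewrite smash_mapD // linear_sum.
  under eq_bigr do rewrite linearZ /= (comul_comatrix _ _ cD) scaler_sumr.
  rewrite exchange_big; apply: memv_suml => l _ /=.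
  under eq_bigr do rewrite -tensZl.
  by rewrite -tens_suml -smash_mapD // memv_tens ?memvf ?memv_Hlambda.
Qed.

(** The axiom with $k = S(h_3)$: $\lambda(h_1)\lambda(S(h_2)) = \lambda(h_1)\lambda(h_2 S(h_3)) =
    \lambda(h)$. *)
Lemma mxf_partial_action_antipode lambda m (D : 'M[H]_m) :
  partial_action lambda -> comatrix D ->
  mxf lambda D *m mxf lambda (map_mx S D) = mxf lambda D.
Proof.
move=> pal cD; apply/matrixP=> i j; rewrite !mxE.
transitivity (\sum_b \sum_a (lambda (D i a) : K) * (lambda (D a b * S (D b j)) : K)).
  by apply: eq_bigr => b _; rewrite (partial_actionD i b _ pal cD) !mxE.
rewrite exchange_big -[RHS](sum_mulr_delta (fun a => lambda (D i a) : K)).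
apply: eq_bigr => a _ /=; rewrite -mulr_sumr; congr (_ * _).
have := congr1 lambda (sum_antipoder a j cD); rewrite linear_sum /= => ->.
by case: (a == j); rewrite ?linear0 // pal.1.
Qed.

Lemma counit_smash_map lambda x : counit (smash_map lambda x) = lambda x.
Proof.
move: x; apply: comatrix_ind => [c x y Px Py|m D cD i j].
  by rewrite !linearP /= Px Py.
rewrite smash_mapD // linear_sum.
rewrite -[RHS](sum_mulr_delta (fun a => lambda (D i a) : K)).
by apply: eq_bigr => k _; rewrite linearZ /= cD.2.
Qed.

(** The convolution product of $\lambda$ and $\mu$ is $\mu \circ E_\lambda$, and the counit of
    $E_\lambda(h)$ is $\lambda(h)$. *)
Lemma partial_action_eval_conv lambda mu m (D : 'M[H]_m) :
  comatrix D -> (forall x, mu (smash_map lambda x) = counit (smash_map lambda x)) ->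
  mxf lambda D *m mxf mu D = mxf lambda D.
Proof.
move=> cD eqm; apply/matrixP=> i j; rewrite [RHS]mxE -counit_smash_map -eqm.
rewrite smash_mapD // linear_sum mxE; apply: eq_bigr => k _ /=.
by rewrite linearZ !mxE.
Qed.

(** The axiom with $k = 1$ says that $\lambda$ is a convolution idempotent, that is, $\lambda(E(h))
    = \lambda(h)$. *)
Lemma partial_action_on_Hlambda lambda x :
  partial_action lambda -> x \in Hlambda lambda -> lambda x = counit x.
Proof.
move=> pal /HlambdaP[y ->]; rewrite -/(smash_map lambda y).
move: y; apply: comatrix_ind => [c y z Py Pz|m D cD i j].
  by rewrite !linearP /= Py Pz.
rewrite counit_smash_map smash_mapD // linear_sum.
have := partial_actionD i j 1 pal cD; rewrite pal.1 mulr1 => <-.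
by apply: eq_bigr => k _; rewrite linearZ /= mulr1.
Qed.

Hypothesis SS : forall x : H, S (S x) = x.

(** The identity for $\lambda$ and $\lambda \circ S$ is used on [D] and on the transposed antipode
    of [D]. Transposition and $S^2 = 1$ give both products the same factors in the same order, so
    $\lambda(D) = \lambda(S(D))$. *)
Lemma partial_action_antipode lambda x : partial_action lambda -> lambda (S x) = lambda x.
Proof.
move=> pal; move: x; apply: comatrix_ind => [c x y Px Py|m D cD i j].
  by rewrite !linearP /= Px Py.
have e1 := mxf_partial_action_antipode pal cD.
have := mxf_partial_action_antipode pal (comatrix_antipode cD).
have -> : map_mx S (map_mx S D)^T = D^T by apply/matrixP=> k l; rewrite !mxE SS.
have mT (X : 'M[H]_m) : mxf lambda X^T = (mxf lambda X)^T.
  by apply/matrixP=> k l; rewrite !mxE.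
rewrite !mT -trmx_mul e1 => /trmx_inj/matrixP/(_ i j).
by rewrite !mxE.
Qed.

Lemma Hlambda_inj lambda mu : partial_action lambda -> partial_action mu ->
  Hlambda lambda = Hlambda mu -> lambda = mu.
Proof.
move=> pal pam eqH.
have lm x : mu (smash_map lambda x) = counit (smash_map lambda x).
  by apply: partial_action_on_Hlambda; rewrite // -eqH memv_Hlambda.
have ml x : lambda (smash_map mu x) = counit (smash_map mu x).
  by apply: partial_action_on_Hlambda; rewrite // eqH memv_Hlambda.
apply/lfunP=> x; move: x; apply: comatrix_ind => [c x y Px Py|m D cD i j].
  by rewrite !linearP /= Px Py.
have tr nu : partial_action nu -> mxf nu (map_mx S D)^T = (mxf nu D)^T.
  by move=> pan; apply/matrixP=> k l; rewrite !mxE partial_action_antipode.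
(* On the antipode comatrix the first relation transposes to $\mu(D)\lambda(D) = \lambda(D)$, while
   the second one on [D] reads $\mu(D)\lambda(D) = \mu(D)$. *)
have := partial_action_eval_conv (comatrix_antipode cD) lm.
rewrite !tr // -trmx_mul (partial_action_eval_conv cD ml) => /trmx_inj/matrixP/(_ i j).
by rewrite !mxE.
Qed.

End PartialActions.

(** If $e \ne 0$, a polynomial $q$ without constant term makes $q(A)$ the projector onto the part
    with nonzero eigenvalues. Its trace, hence its rank in characteristic zero, is $0$, yet it fixes
    $u$. *)
Lemma traces_powers_eigenvalue (K : fieldType) d (A : 'M[K]_d) (u : 'rV[K]_d) e :
  [pchar K] =i pred0 -> (forall k, \tr (A ^+ k.+1) = 0) ->
  u != 0 -> u *m A = e *: u -> e = 0.
Proof.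
move=> chK; case: d A u => [|d] A u trA u0 uA.
  by rewrite thinmx0 eqxx in u0.
apply/eqP; apply: contraT => e0.
have trX (p : {poly K}) k : \tr (horner_mx A (p * 'X^(k.+1))) = 0.
  elim/poly_ind: p k => [|p c IHp] k; first by rewrite mul0r raddf0 raddf0.
  rewrite mulrDl -mulrA -exprS raddfD /= raddfD /= IHp add0r mul_polyC.
  by rewrite linearZ /= mxtraceZ rmorphXn /= horner_mx_X trA mulr0.
have uP (p : {poly K}) : u *m horner_mx A p = p.[e] *: u.
  elim/poly_ind: p => [|p c IHp]; first by rewrite raddf0 horner0 mulmx0 scale0r.
  rewrite rmorphD rmorphM /= horner_mx_X horner_mx_C mulmxDr -mulmxE mulmxA IHp.
  by rewrite -scalemxAl uA mul_mx_scalar scalerA -scalerDl !hornerE.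
have p0 : char_poly A != 0 by rewrite monic_neq0 ?char_poly_monic.
have [k [g nrg pE]] := multiplicity_XsubC (char_poly A) 0.
rewrite p0 /= polyC0 subr0 in nrg pE.
have ge : g.[e] = 0.
  have : root (char_poly A) e.
    rewrite -eigenvalue_root_char; apply/eigenvalueP; by exists u.
  by rewrite pE rootM /root !hornerE ?hornerXn expf_eq0 (negPf e0) andbF orbF => /eqP.
(* The exponent is $k+1$ so that $q$ is divisible by $X$ even when $k = 0$; only then does [trX]
   apply. *)
have cop : coprimep 'X^(k.+1) g.
  by rewrite coprimep_expl // coprimep_sym coprimepX.
have /Bezout_eq1_coprimepP[[s w] /= sw] := cop.
pose q := s * 'X^(k.+1); pose E := horner_mx A q.
have EE : E *m E = E.
  have qq : q * q = q - (s * w * 'X) * char_poly A.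
    rewrite pE; have -> : q * q = q * (1 - w * g) by rewrite -sw addrK.
    rewrite mulrBr mulr1 /q exprS; congr (_ - _).
    by rewrite mulrACA -!mulrA; congr (s * (w * (_ * _))); rewrite mulrC.
  by rewrite mulmxE -rmorphM qq rmorphB [X in _ - X]rmorphM /= Cayley_Hamilton mulr0 subr0.
have E0 : E = 0.
  apply/eqP; rewrite -mxrank_eq0; apply/eqP; apply: (natr_inj_char0 chK).
  by rewrite -trace_idempotent // trX.
have q1 : q.[e] = 1.
  have := congr1 (horner^~ e) sw; rewrite hornerD (hornerM w) ge mulr0 addr0 => ->.
  by rewrite hornerE.
by move/eqP: u0; case; rewrite -[u]scale1r -q1 -uP -/E E0 mulmx0.
Qed.

(** * The conditional expectation onto a coideal subalgebra *)

Section Expectation.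

Variables (K : closedFieldType) (H : hopfType K) (phi : 'Hom(H, K^o)).
Hypothesis chK : [pchar K] =i pred0.
Hypothesis phiP : integral phi.
Local Notation S := (@antipode K H).
Hypothesis SS : forall x : H, S (S x) = x.

Lemma sum_antipode_swap m (D : 'M[H]_m) b c :
  comatrix D -> \sum_a S (D a b) * D c a = (c == b)%:R.
Proof.
move=> cD; have := congr1 S (sum_antipodel c b cD); rewrite linear_sum /=.
under eq_bigr do rewrite antipodeM SS.
by move=> ->; case: (c == b); rewrite ?linear0 ?antipode1.
Qed.

(** In Sweedler notation, $\varphi(x y_1) y_2 = \varphi(x_1 y) S(x_2)$: invariance of $\varphi$ at
    $x_1 y$, followed by cancelling with the reversed antipode identity that $S^2 = 1$ provides. *)
Lemma integral_shift m p (v : 'I_m -> H) D (w : 'I_p -> H) E b i :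
  corow v D -> comatrix D -> corow w E ->
  \sum_j (phi (v b * w j) : K) *: E j i = \sum_a (phi (v a * w i) : K) *: S (D a b).
Proof.
move=> vD cD wE.
transitivity (\sum_a S (D a b) *
    (\sum_c \sum_j (phi (v c * w j) : K) *: (D c a * E j i))); last first.
  apply: eq_bigr => a _; rewrite (integral_mull phiP a i vD wE).
  by rewrite -scalerAr mulr1.
under [RHS]eq_bigr => a _ do rewrite mulr_sumr.
rewrite exchange_big /= -[LHS]mul1r.
under [RHS]eq_bigr => c _ do under eq_bigr => a _ do rewrite mulr_sumr.
under [RHS]eq_bigr => c _ do rewrite exchange_big.
rewrite exchange_big mul1r; apply: eq_bigr => j _ /=.
rewrite -[LHS](sum_delta (fun c => (phi (v c * w j) : K) *: E j i)).
apply: eq_bigr => c _; under eq_bigr => a _ do rewrite -scalerAr mulrA.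
rewrite -scaler_sumr -mulr_suml sum_antipode_swap //.
by case: (c == b); rewrite ?mul1r ?mul0r ?scale1r ?scale0r ?scaler0.
Qed.

Variable B : {vspace H}.
Hypothesis B1 : 1 \in B.
Hypothesis BM : (B * B <= B)%VS.
Local Notation d := (\dim B).
Local Notation v := (vbasis B).
Variable D : 'M[H]_d.
Hypothesis vD : corow (fun i : 'I_d => v`_i) D.
Hypothesis cD : comatrix D.

Lemma trace_lmul_coideal z : z \in B -> \tr (lmul_mx B z) = d%:R * (phi z : K).
Proof.
have QD : cst H 1%:M *m D = map_mx (fun x => S (S x)) D *m cst H 1%:M.
  by rewrite cst1 mul1mx mulmx1; apply/matrixP=> i j; rewrite mxE SS.
by move=> zB; have := trace_lmul BM phiP vD cD QD zB; rewrite mul1mx mxtrace1.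
Qed.

(** The traces of all positive powers of $L_z$ on $B$ vanish, being multiples of $\varphi(z^k z)$.
    The row of counit values is a nonzero left eigenvector of $L_z$ with eigenvalue
    $\varepsilon(z)$. *)
Lemma counit_radical z : z \in B -> (forall b, b \in B -> phi (b * z) = 0) ->
  counit z = 0.
Proof.
move=> zB phiz; pose u : 'rV[K]_d := \row_j (counit v`_j : K).
have zk k : z ^+ k \in B.
  elim: k => [|k IHk]; first by rewrite expr0.
  by rewrite exprS; apply: (subvP BM); rewrite memv_mul.
have LX k : lmul_mx B (z ^+ k) = lmul_mx B z ^+ k.
  elim: k => [|k IHk]; first by rewrite !expr0 lmul_mx1.
  by rewrite !exprS lmul_mxM // IHk.
apply: (@traces_powers_eigenvalue K d (lmul_mx B z) u _ chK).
- move=> k; rewrite -LX trace_lmul_coideal // exprSr phiz ?mulr0 //.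
- apply/eqP => u0; have := oner_neq0 K; case/eqP.
  rewrite -[LHS]/(1 : K^o) -(counit1 (s := H)) (coord_vbasis B1) linear_sum.
  rewrite big1 // => j _; rewrite linearZ /=.
  by have /rowP/(_ j) := u0; rewrite !mxE => ->; rewrite scaler0.
apply/rowP=> j; rewrite !mxE.
transitivity (counit (z * v`_j) : K); last by rewrite counitM.
rewrite (lmul_mxE BM j zB) linear_sum; apply: eq_bigr => k _.
by rewrite linearZ !mxE mulrC.
Qed.

Definition gram : 'M[K]_d := \matrix_(a, j) (phi (v`_a * v`_j) : K).

(** The radical is a right coideal by [integral_shift]: for any functional $f$ it contains [zf],
    which is $z_1 f(z_2)$. The counit of this element is $f(z)$, so every $f$ vanishes at $z$. *)
Lemma coideal_nondegenerate z :
  z \in B -> (forall b, b \in B -> phi (b * z) = 0) -> z = 0.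
Proof.
move=> zB phiz; pose be i : K := coord v i z.
have zE : z = \sum_(i < d) be i *: v`_i by apply: coord_vbasis.
apply: functionals_separate => f; rewrite linear0.
pose zf := \sum_(i < d) \sum_(j < d) (be i * (f (D j i) : K)) *: v`_j.
have zfB : zf \in B.
  by apply: memv_suml => i _; apply: memv_suml => j _; rewrite memvZ ?vbasis_in.
have W0 (a : 'I_d) : \sum_i be i * (phi (v`_a * v`_i) : K) = 0.
  have := phiz v`_a (vbasis_in a); rewrite {1}zE mulr_sumr linear_sum => eq0; rewrite -[RHS]eq0.
  by apply: eq_bigr => i _; rewrite -scalerAr linearZ.
have zf0 (b : 'I_d) : phi (v`_b * zf) = 0.
  have : \sum_i be i *: \sum_(j < d) (phi (v`_b * v`_j) : K) *: D j i = 0.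
    under eq_bigr => i _ do rewrite (integral_shift b i vD cD vD) scaler_sumr.
    rewrite exchange_big big1 // => a _ /=.
    under eq_bigr => i _ do rewrite scalerA.
    by rewrite -scaler_suml W0 scale0r.
  move/(congr1 f); rewrite linear0 => f0.
  rewrite -[RHS]f0 linear_sum mulr_sumr linear_sum; apply: eq_bigr => i _ /=.
  rewrite mulr_sumr linear_sum [RHS]linearZ /= [f _]linear_sum scaler_sumr.
  apply: eq_bigr => j _ /=.
  rewrite -scalerAr !linearZ /=.
  exact: mulrC.
have zfJ b : b \in B -> phi (b * zf) = 0.
  move=> bB; rewrite (coord_vbasis bB) mulr_suml linear_sum big1 // => j _.
  by rewrite -scalerAl linearZ /= zf0 scaler0.
have := counit_radical zfB zfJ; rewrite linear_sum => e0.
rewrite -[RHS]e0 {1}zE linear_sum; apply: eq_bigr => i _ /=.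
rewrite linearZ /= -{1}[v`_i]sweedler_counitl.
rewrite (sweedler_corow i vD (@counit_bilinear K H)) !linear_sum.
apply: eq_bigr => j _ /=; rewrite !linearZ /=.
exact: mulrC.
Qed.

Lemma gram_unit : gram \in unitmx.
Proof.
rewrite -unitmx_tr -row_free_unit -kermx_eq0; apply/rowV0P=> u /sub_kermxP uW.
pose z := \sum_(i < d) u 0 i *: v`_i.
have z0 : z = 0.
  apply: coideal_nondegenerate => [|b bB].
    by apply: memv_suml => i _; rewrite memvZ ?vbasis_in.
  rewrite (coord_vbasis bB) mulr_suml linear_sum big1 // => a _.
  rewrite -scalerAl linearZ /= [X in _ *: X](_ : _ = 0) ?scaler0 //.
  have /rowP/(_ a) := uW; rewrite !mxE => eq0; rewrite -[RHS]eq0 mulr_sumr linear_sum.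
  by apply: eq_bigr => i _; rewrite -scalerAr linearZ !mxE.
apply/rowP=> i; rewrite mxE.
have /freeP := basis_free (vbasisP B); apply; exact: z0.
Qed.

(** The coordinates of [p h] solve the Gram system with right-hand side $\varphi(v_a h)$. *)
Lemma expectation_exists : exists p : 'End(H),
  (forall h, p h \in B) /\ forall b h, b \in B -> phi (b * p h) = phi (b * h).
Proof.
have [|p pE] := @lfun_exists K H H (fun h => \sum_(j < d)
    (\sum_a invmx gram j a * (phi (v`_a * h) : K)) *: v`_j).
  move=> c x y; rewrite scaler_sumr -big_split; apply: eq_bigr => j _ /=.
  rewrite scalerA -scalerDl; congr (_ *: _).
  rewrite mulr_sumr -big_split; apply: eq_bigr => a _ /=.
  by rewrite mulrDr -scalerAr linearP mulrDr mulrCA.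
exists p; split=> [h|b h bB]; rewrite ?pE.
  by apply: memv_suml => j _; rewrite memvZ ?vbasis_in.
rewrite (coord_vbasis bB) !mulr_suml !linear_sum; apply: eq_bigr => c _.
rewrite -!scalerAl !linearZ; congr (_ *: _).
transitivity ((gram *m invmx gram *m \col_a (phi (v`_a * h) : K)) c 0); last first.
  by rewrite mulmxV ?gram_unit // mul1mx mxE.
rewrite -mulmxA mxE mulr_sumr linear_sum; apply: eq_bigr => j _ /=.
rewrite -scalerAr linearZ !mxE mulrC; congr (_ * _).
by apply: eq_bigr => a _; rewrite mxE.
Qed.

Lemma coideal_subalgebra_Hlambda :
  exists lambda : 'Hom(H, K^o), partial_action lambda /\ B = Hlambda lambda.
Proof.
have [p [pB pphi]] := expectation_exists.
have p_uniq x y : x \in B -> y \in B ->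
    (forall b, b \in B -> phi (b * x) = phi (b * y)) -> x = y.
  move=> xB yB xy; apply/eqP; rewrite -subr_eq0; apply/eqP.
  apply: coideal_nondegenerate => [|b bB]; first exact: memvB.
  by rewrite mulrBr linearB /= xy // subrr.
have pid b : b \in B -> p b = b.
  by move=> bB; apply: p_uniq => // c cB; apply: pphi.
have BMm x y : x \in B -> y \in B -> x * y \in B.
  by move=> xB yB; apply: (subvP BM); apply: memv_mul.
have pl b h : b \in B -> p (b * h) = b * p h.
  move=> bB; apply: p_uniq => [||c cB]; rewrite ?BMm //.
  by rewrite pphi // !mulrA pphi ?BMm.
pose lambda := (counit \o p)%VF.
have lambdaE h : lambda h = counit (p h) by rewrite lfunE.
have smashE h : smash_map lambda h = p h.
  move: h; apply: comatrix_ind => [c x y Px Py|m E cE i j].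
    by rewrite !linearP /= Px Py.
  have pcorow : corow (fun j => p (E i j)) E.
    move=> j'; have pc l : p (E i l) = \sum_(c < d) coord v c (p (E i l)) *: v`_c.
      exact: coord_vbasis.
    pose Y : 'M[K]_(d, m) := \matrix_(c, l) coord v c (p (E i l)).
    have DY : D *m cst H Y = cst H Y *m E.
      have gE (b : 'I_d) l : (gram *m Y) b l = (phi (v`_b * E i l) : K).
        rewrite -pphi ?vbasis_in // (pc l) mulr_sumr linear_sum mxE.
        by apply: eq_bigr => c _; rewrite -scalerAr linearZ !mxE mulrC.
      (* Both sides equal $\sum_a \varphi(v_a E_{il}) S(D_{ab})$: [integral_shift] is applied to the
         $E_{il}$ and to the basis of $B$ in which their projections are expanded, and $\varphi$
         against $B$ does not distinguish the two. The invertible Gram matrix then cancels. *)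
      have gDY : cst H gram *m (D *m cst H Y) = cst H gram *m (cst H Y *m E).
        apply/matrixP=> b l; rewrite [in RHS]mulmxA -cstM [LHS]mul_cstl [RHS]mul_cstl.
        under [RHS]eq_bigr do rewrite gE.
        rewrite (integral_shift b l vD cD (cE.1 i)).
        transitivity (\sum_c Y c l *: \sum_(j < d) (phi (v`_b * v`_j) : K) *: D j c).
          under eq_bigr do rewrite mul_cstr scaler_sumr.
          rewrite exchange_big; apply: eq_bigr => c _ /=.
          rewrite scaler_sumr; apply: eq_bigr => k _.
          by rewrite mxE !scalerA mulrC.
        under eq_bigr => c _ do rewrite (integral_shift b c vD cD vD) scaler_sumr.
        rewrite exchange_big; apply: eq_bigr => a _ /=.
        under eq_bigr do rewrite scalerA.
        rewrite -scaler_suml -gE mxE; congr (_ *: _).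
        by apply: eq_bigr => c _; rewrite mulrC [gram a c]mxE.
      move/(congr1 (mulmx (cst H (invmx gram)))): gDY.
      by rewrite !mulmxA -!cstM mulVmx ?gram_unit // cst1 !mul1mx.
    rewrite pc linear_sum /=.
    under eq_bigr do rewrite linearZ /= vD scaler_sumr.
    under [RHS]eq_bigr do rewrite pc tens_suml.
    rewrite exchange_big [RHS]exchange_big; apply: eq_bigr => k _ /=.
    under eq_bigr do rewrite -tensZr.
    under [RHS]eq_bigr do rewrite tensZl -tensZr.
    rewrite -!tens_sumr; congr tens.
    have /matrixP/(_ k j') := DY; rewrite mul_cstr mul_cstl => eqk.
    transitivity (\sum_c Y c j' *: D k c); first by apply: eq_bigr => c _; rewrite mxE.
    by rewrite eqk; apply: eq_bigr => c _; rewrite mxE.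
  rewrite smash_mapD // -[RHS]sweedler_counitl.
  rewrite (sweedler_corow j pcorow (@counit_bilinear K H)).
  by apply: eq_bigr => k _; rewrite lambdaE.
have lambdaM b h : b \in B -> lambda (b * h) = (counit b : K) * (lambda h : K).
  by move=> bB; rewrite !lambdaE pl // counitM.
exists lambda; split.
  split=> [|h k]; first by rewrite lambdaE pid // counit1.
  (* The right-hand side of the axiom is $\lambda(E(h)k)$ with $E(h)$ in $B$, so $B$-linearity
     splits it as $\varepsilon(E(h))\lambda(k) = \lambda(h)\lambda(k)$. *)
  transitivity (lambda (smash_map lambda h * k) : K).
    by rewrite smashE lambdaM ?pB // !lambdaE.
  move: h; apply: comatrix_ind => [c x y Px Py|m E cE i j].
    rewrite linearP mulrDl -scalerAl linearP /= Px Py /sweedler !linearP //.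
  rewrite smash_mapD // mulr_suml linear_sum (sweedler_comatrix i j cE).
    by apply: eq_bigr => a _; rewrite -scalerAl linearZ.
  split=> [w|u] c x y /=; first by rewrite linearP mulrDl -scalerAl.
  by rewrite mulrDl -scalerAl linearP mulrDr -scalerAr.
apply/vspaceP=> x; apply/idP/idP => [xB|/HlambdaP[h ->]].
  by apply/HlambdaP; exists x; rewrite -/(smash_map _ _) smashE pid.
by rewrite -/(smash_map _ _) smashE.
Qed.

End Expectation.

Theorem mainTheorem10 (K : closedFieldType) (H : hopfType K)
    (charK0 : [pchar K]%R =i pred0) (cosemiH : cosemisimple H) :
  [/\ forall lambda : 'Hom(H, K^o),
        partial_action lambda -> right_coideal_subalgebra (Hlambda lambda),
      forall B : {vspace H}, right_coideal_subalgebra B ->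
        exists lambda : 'Hom(H, K^o),
          partial_action lambda /\ B = Hlambda lambda
    & forall lambda mu : 'Hom(H, K^o),
        partial_action lambda -> partial_action mu ->
        Hlambda lambda = Hlambda mu -> lambda = mu].
Proof.
have SS := antipode_involutive charK0 cosemiH.
have [phi phiP] := integral_exists cosemiH.
split.
- exact: Hlambda_coideal_subalgebra.
- move=> B [B1 BM BD]; have [D [vD cD _]] := coideal_comatrix BD.
  exact: (coideal_subalgebra_Hlambda charK0 phiP SS B1 BM vD cD).
- exact: Hlambda_inj.
Qed.
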